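(* Let $R$ be a commutative Noetherian ring and let $N$ be a finite $R$-module. The following are equivalent: (1) $\mathrm{id}_{R_{\mathfrak p}}\, N_{\mathfrak p} < \infty$ for every $\mathfrak p \in \mathrm{Spec}\, R$; (2) for every finite $R$-module $M$, there exists an integer $n$ (allowed to depend on $M$) such that $\mathrm{Ext}_R^i(M,N) = 0$ for all $i > n$.
   Context: ''Finite module'' means finitely generated module. $\mathrm{id}_{R_{\mathfrak p}}\, N_{\mathfrak p}$ denotes the injective dimension of the localization $N_{\mathfrak p}$ as a module over the local ring $R_{\mathfrak p}$ (the zero module is regarded as having finite injective dimension). The ring $R$ is not assumed to have finite Krull dimension. *)

(* Defs.v *)
From HB Require Import structures.
From mathcomp Require Import all_boot all_order all_algebra.
From mathcomp Require Import generic_quotient ring_quotient.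
From mathcomp Require Import boolp classical_sets functions cardinality fsbigop.
From mathcomp Require Import ring.

Set Implicit Arguments.
Unset Strict Implicit.
Unset Printing Implicit Defensive.

Import GRing.Theory.

Local Open Scope quotient_scope.
Local Open Scope ring_scope.

(* Subsets are boolean predicates; by [boolp.asbool] every subset is one. *)

(** * Submodules and quotient modules *)

Section Submodule.
Variables (R : comPzRingType) (V : lmodType R) (S : submodClosed V).

Record submod : Type := Submod {
  submod_val :> V;
  submod_valP : submod_val \in S
}.

HB.instance Definition _ := [isSub for submod_val].
HB.instance Definition _ := [Choice of submod by <:].
HB.instance Definition _ := [SubChoice_isSubLmodule of submod by <:].

End Submodule.

Section QuotientModule.
Variables (R : comPzRingType) (V : lmodType R) (S : submodClosed V).

(* A [submodClosed] predicate does not coerce to [zmodClosed]. *)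
Definition quotmod_pred : {pred V} := fun x => x \in S.

HB.instance Definition _ := GRing.isZmodClosed.Build V quotmod_pred
  (GRing.submod_closedB (submodClosedP S)).

Definition quotmod : Type := Quotient.quot quotmod_pred.

HB.instance Definition _ := GRing.Zmodule.on quotmod.

Definition quotmod_pi (x : V) : quotmod := \pi_(Quotient.quot quotmod_pred) x.

Definition quotmod_scale (a : R) (x : quotmod) : quotmod :=
  quotmod_pi (a *: repr (x : Quotient.quot quotmod_pred)).

Lemma quotmod_piP x y : quotmod_pi x = quotmod_pi y <-> x - y \in S.
Proof.
rewrite -[x - y \in S]/(x - y \in quotmod_pred) Quotient.idealrBE.
by split=> /eqP.
Qed.

Lemma quotmod_piD x y : quotmod_pi (x + y) = quotmod_pi x + quotmod_pi y.
Proof. exact: (raddfD \pi_(Quotient.quot quotmod_pred)). Qed.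

Lemma quotmod_piK (x : quotmod) :
  quotmod_pi (repr (x : Quotient.quot quotmod_pred)) = x.
Proof. exact: reprK. Qed.

Lemma quotmod_piZ a x : quotmod_pi (a *: x) = quotmod_scale a (quotmod_pi x).
Proof.
apply/quotmod_piP; rewrite -scalerBr rpredZ //.
by apply/quotmod_piP; rewrite quotmod_piK.
Qed.

Lemma quotmod_scaleA a b x :
  quotmod_scale a (quotmod_scale b x) = quotmod_scale (a * b) x.
Proof. by rewrite -[x]quotmod_piK -!quotmod_piZ scalerA. Qed.

Lemma quotmod_scale1 : left_id 1 quotmod_scale.
Proof. by move=> x; rewrite -[x]quotmod_piK -!quotmod_piZ scale1r. Qed.

Lemma quotmod_scaleDr : right_distributive quotmod_scale +%R.
Proof.
move=> a x y; rewrite -[x]quotmod_piK -[y]quotmod_piK.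
by rewrite -quotmod_piD -!quotmod_piZ scalerDr quotmod_piD.
Qed.

Lemma quotmod_scaleDl x : {morph quotmod_scale^~ x : a b / a + b}.
Proof.
move=> a b; rewrite -[x]quotmod_piK.
by rewrite -!quotmod_piZ scalerDl quotmod_piD.
Qed.

HB.instance Definition _ := GRing.Zmodule_isLmodule.Build R quotmod
  quotmod_scaleA quotmod_scale1 quotmod_scaleDr quotmod_scaleDl.

End QuotientModule.

(** * Finite modules and Noetherian rings *)

Definition finite_module (R : comPzRingType) (M : lmodType R) : Prop :=
  exists (n : nat) (g : 'I_n -> M),
    forall x : M, exists c : 'I_n -> R, x = \sum_i c i *: g i.

Definition noetherian (R : comPzRingType) : Prop :=
  forall I : submodClosed R^o, finite_module (submod I).

(** * Prime ideals *)

(* [prime_idealr] of the library is restricted to nontrivial rings. *)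
Record spec (R : comPzRingType) := Spec {
  spec_pred :> {pred R^o};
  spec_submod : submod_closed spec_pred;
  spec_proper : (1 : R) \notin spec_pred;
  spec_prime : forall a b : R,
    a * b \in spec_pred -> (a \in spec_pred) || (b \in spec_pred)
}.

Arguments spec_submod {R} s.
Arguments spec_proper {R} s.
Arguments spec_prime {R} s a b.

(** * Localization at a prime ideal *)

Section Localization.
Variables (R : comPzRingType) (p : spec R).

Lemma spec_compl1 : (1 : R) \notin p. Proof. exact: spec_proper. Qed.

Lemma spec_complM (a b : R) : a \notin p -> b \notin p -> a * b \notin p.
Proof.
move=> ap bp; apply/negP => /(spec_prime p); apply/negP.
by rewrite negb_or ap.
Qed.

Record denom : Type := Denom {
  denom_val : R;
  denom_valP : denom_val \notin p
}.

HB.instance Definition _ := [isSub for denom_val].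
HB.instance Definition _ := [Choice of denom by <:].

Definition denom1 : denom := Denom spec_compl1.
Definition denomM (s t : denom) : denom :=
  Denom (spec_complM (denom_valP s) (denom_valP t)).

Section LocMod.
Variable N : lmodType R.

(* [x / s = y / t] iff [c t x = c s y] for some [c] outside [p]. *)
Definition frac_equiv (u v : N * denom) : bool :=
  `[< exists c : denom,
        denom_val c *: (denom_val v.2 *: u.1) =
        denom_val c *: (denom_val u.2 *: v.1) >].

Lemma frac_equiv_refl : reflexive frac_equiv.
Proof. by move=> u; apply/asboolP; exists denom1. Qed.

Lemma frac_equiv_sym : symmetric frac_equiv.
Proof.
by move=> u v; apply/asboolP/asboolP => -[c e]; exists c; rewrite e.
Qed.

Lemma frac_equiv_trans : transitive frac_equiv.
Proof.
move=> [y t] [x s] [z r] /asboolP[c /= e] /asboolP[d /= f].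
apply/asboolP; exists (denomM (denomM c d) t) => /=.
transitivity ((denom_val d * denom_val r) *: (denom_val c *: (denom_val t *: x))).
  by rewrite !scalerA; congr (_ *: _); ring.
transitivity ((denom_val c * denom_val s) *: (denom_val d *: (denom_val r *: y))).
  by rewrite e !scalerA; congr (_ *: _); ring.
by rewrite f !scalerA; congr (_ *: _); ring.
Qed.

Canonical frac_equivRel :=
  EquivRel frac_equiv frac_equiv_refl frac_equiv_sym frac_equiv_trans.

Definition locmod : Type := {eq_quot frac_equiv}.

HB.instance Definition _ := Choice.on locmod.

(* The fraction [x / s]. *)
Definition locfrac (x : N) (s : denom) : locmod := \pi_(locmod) (x, s).

Lemma locfracP x s y t : locfrac x s = locfrac y t <->
  exists c : denom,
    denom_val c *: (denom_val t *: x) = denom_val c *: (denom_val s *: y).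
Proof.
split=> [/eqP|h].
  by rewrite /locfrac piE => /asboolP[c e]; exists c.
by apply/eqP; rewrite /locfrac piE; apply/asboolP.
Qed.

Definition locnum (u : locmod) : N := (repr u).1.
Definition locden (u : locmod) : denom := (repr u).2.

Lemma locfrac_num_den u : locfrac (locnum u) (locden u) = u.
Proof. by rewrite /locfrac /locnum /locden -surjective_pairing reprK. Qed.

Lemma locfracE u : exists x s, u = locfrac x s.
Proof. by exists (locnum u), (locden u); rewrite locfrac_num_den. Qed.

Definition locmod_add (u v : locmod) : locmod :=
  locfrac (denom_val (locden v) *: locnum u + denom_val (locden u) *: locnum v)
    (denomM (locden u) (locden v)).
Definition locmod_opp (u : locmod) : locmod := locfrac (- locnum u) (locden u).

Lemma locmod_addE x s y t :
  locmod_add (locfrac x s) (locfrac y t) =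
  locfrac (denom_val t *: x + denom_val s *: y) (denomM s t).
Proof.
rewrite /locmod_add; set u := locfrac x s; set v := locfrac y t.
have /locfracP[c /= e] : locfrac (locnum u) (locden u) = locfrac x s
  by rewrite locfrac_num_den.
have /locfracP[d /= f] : locfrac (locnum v) (locden v) = locfrac y t
  by rewrite locfrac_num_den.
apply/locfracP; exists (denomM c d) => /=; rewrite !scalerDr; congr (_ + _).
  transitivity ((denom_val d * denom_val t * denom_val (locden v)) *:
                (denom_val c *: (denom_val s *: locnum u))).
    by rewrite !scalerA; congr (_ *: _); ring.
  by rewrite e !scalerA; congr (_ *: _); ring.
transitivity ((denom_val c * denom_val s * denom_val (locden u)) *:
              (denom_val d *: (denom_val t *: locnum v))).
  by rewrite !scalerA; congr (_ *: _); ring.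
by rewrite f !scalerA; congr (_ *: _); ring.
Qed.

Lemma locmod_oppE x s : locmod_opp (locfrac x s) = locfrac (- x) s.
Proof.
rewrite /locmod_opp; set u := locfrac x s.
have /locfracP[c /= e] : locfrac (locnum u) (locden u) = locfrac x s
  by rewrite locfrac_num_den.
by apply/locfracP; exists c; rewrite !scalerN e.
Qed.

Lemma locmod_addA : associative locmod_add.
Proof.
move=> u v w; have [x [s ->]] := locfracE u; have [y [t ->]] := locfracE v.
have [z [r ->]] := locfracE w; rewrite !locmod_addE; apply/locfracP; exists denom1.
by rewrite /= !scalerDr !scalerA addrA; congr (_ + _ + _); congr (_ *: _); ring.
Qed.

Lemma locmod_addC : commutative locmod_add.
Proof.
move=> u v; have [x [s ->]] := locfracE u; have [y [t ->]] := locfracE v.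
rewrite !locmod_addE; apply/locfracP; exists denom1 => /=.
by rewrite addrC; congr (_ *: (_ *: _)); ring.
Qed.

Lemma locmod_add0 : left_id (locfrac 0 denom1) locmod_add.
Proof.
move=> u; have [x [s ->]] := locfracE u; rewrite locmod_addE.
by rewrite scaler0 add0r scale1r; apply/locfracP; exists denom1; rewrite /= mul1r.
Qed.

Lemma locmod_addN : left_inverse (locfrac 0 denom1) locmod_opp locmod_add.
Proof.
move=> u; have [x [s ->]] := locfracE u; rewrite locmod_oppE locmod_addE.
by rewrite scalerN addNr; apply/locfracP; exists denom1; rewrite !scaler0.
Qed.

HB.instance Definition _ := GRing.isZmodule.Build locmod
  locmod_addA locmod_addC locmod_add0 locmod_addN.

End LocMod.

Definition locring : Type := locmod R^o.

HB.instance Definition _ := GRing.Zmodule.on locring.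

(* [(a / s) (x / t) = (a x) / (s t)]; on [N = R^o] this is the product of the
   ring [locring]. *)
Definition locscale (N : lmodType R) (a : locring) (u : locmod N) : locmod N :=
  locfrac ((locnum a : R) *: locnum u) (denomM (locden a) (locden u)).

Section LocScale.
Variable N : lmodType R.
Implicit Types u v : locmod N.

Lemma locscaleE (a : R) s (x : N) t :
  locscale (locfrac (a : R^o) s) (locfrac x t) = locfrac (a *: x) (denomM s t).
Proof.
rewrite /locscale; set b := locfrac (a : R^o) s; set u := locfrac x t.
have /locfracP[c /= e] : locfrac (locnum b) (locden b) = locfrac (a : R^o) s.
  by rewrite locfrac_num_den.
have /locfracP[d /= f] : locfrac (locnum u) (locden u) = locfrac x t
  by rewrite locfrac_num_den.
apply/locfracP; exists (denomM c d) => /=.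
transitivity ((denom_val c * (denom_val s * (locnum b : R))) *:
              (denom_val d *: (denom_val t *: locnum u))).
  by rewrite !scalerA; congr (_ *: _); ring.
rewrite [X in X *: _](e : _ = denom_val c * (denom_val (locden b) * a)) f !scalerA.
by congr (_ *: _); ring.
Qed.

Lemma locfracDr x y s : locfrac (x + y) s = locfrac x s + locfrac y s :> locmod N.
Proof.
rewrite [RHS]locmod_addE; apply/locfracP; exists denom1.
by rewrite /= -scalerDr !scalerA; congr (_ *: _); ring.
Qed.

Lemma frac_common u v : exists x y s, u = locfrac x s /\ v = locfrac y s.
Proof.
have [x [s ->]] := locfracE u; have [y [t ->]] := locfracE v.
exists (denom_val t *: x), (denom_val s *: y), (denomM s t).
by split; apply/locfracP; exists denom1; rewrite /= !scalerA;
  congr (_ *: _); ring.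
Qed.

End LocScale.

Lemma locscaleA (N : lmodType R) a b (u : locmod N) :
  locscale a (locscale b u) = locscale (locscale a b : locring) u.
Proof.
have [x [s ->]] := locfracE a; have [y [t ->]] := locfracE b.
have [z [r ->]] := locfracE u.
rewrite (locscaleE y t z r) (locscaleE x s y t) !locscaleE.
apply/locfracP; exists denom1; rewrite /= !scalerA; congr (_ *: _).
by rewrite /GRing.scale /=; ring.
Qed.

Definition locring1 : locring := locfrac (1 : R^o) denom1.

Lemma locscale1 (N : lmodType R) : left_id locring1 (@locscale N).
Proof.
move=> u; have [x [s ->]] := locfracE u; rewrite locscaleE.
by apply/locfracP; exists denom1; rewrite /= !scalerA !mul1r !mulr1.
Qed.

Lemma locscaleDr (N : lmodType R) : right_distributive (@locscale N) +%R.
Proof.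
move=> a u v; have [b [s ->]] := locfracE a.
have [x [y [t [-> ->]]]] := frac_common u v.
by rewrite -locfracDr !locscaleE scalerDr locfracDr.
Qed.

Lemma locscaleDl (N : lmodType R) u : {morph (@locscale N)^~ u : a b / a + b}.
Proof.
move=> a b; have [x [s ->]] := locfracE u.
have [y [z [t [-> ->]]]] := frac_common a b.
by rewrite -locfracDr !locscaleE scalerDl locfracDr.
Qed.

Lemma locringC : commutative (@locscale R^o : locring -> locring -> locring).
Proof.
move=> a b; have [x [s ->]] := locfracE a; have [y [t ->]] := locfracE b.
rewrite !locscaleE; apply/locfracP; exists denom1.
by rewrite /GRing.scale /=; ring.
Qed.

Lemma locringA : associative (@locscale R^o : locring -> locring -> locring).
Proof. by move=> a b c; rewrite locscaleA. Qed.

Lemma locring_mulDl :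
  left_distributive (@locscale R^o : locring -> locring -> locring) +%R.
Proof. by move=> a b c; rewrite locscaleDl. Qed.

HB.instance Definition _ := GRing.Zmodule_isComPzRing.Build locring
  locringA locringC (@locscale1 R^o) locring_mulDl.

HB.instance Definition _ (N : lmodType R) :=
  GRing.Zmodule_isLmodule.Build locring (locmod N)
  (@locscaleA N) (@locscale1 N) (@locscaleDr N) (@locscaleDl N).

End Localization.

(** * Injective dimension *)

Definition injective_module (A : comPzRingType) (I : lmodType A) : Prop :=
  forall (U V : lmodType A) (i : {linear U -> V}) (f : {linear U -> I}),
    injective i -> exists g : {linear V -> I}, forall x, g (i x) = f x.

Record injective_resolution (A : comPzRingType) (N : lmodType A) :=
    InjectiveResolution {
  ires :> nat -> lmodType A;
  ires_d : forall i, {linear ires i -> ires i.+1};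
  ires_aug : {linear N -> ires 0};
  ires_injective : forall i, injective_module (ires i);
  ires_aug_inj : injective ires_aug;
  ires_exact0 : forall x, ires_d 0 x = 0 <-> exists y, ires_aug y = x;
  ires_exact : forall i x, ires_d i.+1 x = 0 <-> exists y, ires_d i y = x
}.

Definition zero_module (A : comPzRingType) (M : lmodType A) : Prop :=
  forall x : M, x = 0.

Definition injdim_le (A : comPzRingType) (N : lmodType A) (n : nat) : Prop :=
  exists I : injective_resolution N, forall i, (n < i)%N -> zero_module (I i).

(* The zero module has finite injective dimension, by the zero resolution. *)
Definition finite_injdim (A : comPzRingType) (N : lmodType A) : Prop :=
  exists n : nat, injdim_le N n.

(** * Free modules and the standard free resolution *)

Section FreeModule.
Variables (R : comPzRingType) (T : Type).

Definition fin_supp : {pred T -> R^o} :=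
  fun f => `[< finite_set [set t | f t != 0] >].

Lemma fin_supp_submod : submod_closed fin_supp.
Proof.
split=> [|a f g /asboolP ff /asboolP fg]; apply/asboolP.
  by apply: (sub_finite_set _ (finite_set0 T)) => t /=; rewrite eqxx.
have : finite_set ([set t | f t != 0] `|` [set t | g t != 0]).
  by rewrite finite_setU.
apply: sub_finite_set => t /=.
case: (eqVneq (f t) 0) => [f0|]; last by left.
case: (eqVneq (g t) 0) => [g0|]; last by right.
by rewrite !fctE f0 g0 scaler0 addr0 eqxx.
Qed.

HB.instance Definition _ := GRing.isSubmodClosed.Build R (T -> R^o) fin_supp
  (GRing.submod_closed_semi fin_supp_submod).

Definition freemod : Type := submod fin_supp.

HB.instance Definition _ := GRing.Lmodule.on freemod.

End FreeModule.

Arguments fin_supp : clear implicits.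

Section FreeCover.
Variables (R : comPzRingType) (M : lmodType R).

(* The canonical surjection from the free module on the set [M] onto [M]. *)
Definition fm_eval (f : freemod R M) : M :=
  \sum_(m \in [set: M]) (val f m : R) *: m.

Lemma fm_eval_on (D : set M) (f : freemod R M) : finite_set D ->
  (forall m, val f m != 0 -> D m) ->
  fm_eval f = \sum_(m \in D) (val f m : R) *: m.
Proof.
move=> Dfin fD; symmetry; apply: fsbig_widen => // m [_ nDm] /=.
have [->|/fD //] := eqVneq (val f m) 0; exact: scale0r.
Qed.

Lemma fm_eval_linear : linear fm_eval.
Proof.
move=> a f g; have /asboolP ff := valP f; have /asboolP fg := valP g.
set D := ([set m | val f m != 0] `|` [set m | val g m != 0])%classic.
have Dfin : finite_set D by rewrite finite_setU.
rewrite (@fm_eval_on D f) //; last by move=> m h; left.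
rewrite (@fm_eval_on D g) //; last by move=> m h; right.
rewrite (@fm_eval_on D (a *: f + g)) //; last first.
  move=> m; rewrite linearP !fctE /D /=.
  case: (eqVneq (val f m) 0) => [-> |]; last by left.
  case: (eqVneq (val g m) 0) => [-> |]; last by right.
  by rewrite scaler0 addr0 eqxx.
rewrite !fsbig_finite //= scaler_sumr -big_split /=; apply: eq_bigr => m _.
by rewrite scalerA -scalerDl.
Qed.

HB.instance Definition _ :=
  GRing.isLinear.Build R (freemod R M) M *:%R fm_eval fm_eval_linear.

Lemma fm_eval_surj m : exists f, fm_eval f = m.
Proof.
pose d : M -> R^o := fun x => (x == m)%:R.
have dfin : d \in fin_supp R M.
  apply/asboolP; apply: (sub_finite_set _ (finite_set1 m)) => x /=.
  by rewrite /d; case: (eqVneq x m) => //; rewrite eqxx.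
exists (Submod dfin); rewrite (@fm_eval_on [set m]) //=.
  by rewrite fsbig_set1 /d eqxx scale1r.
by move=> x; rewrite /d; case: (eqVneq x m) => //; rewrite eqxx.
Qed.

Definition fm_ker : {pred freemod R M} := fun f => fm_eval f == 0.

Lemma fm_ker_submod : submod_closed fm_ker.
Proof.
split=> [|a f g]; rewrite !unfold_in; first by rewrite linear0.
by move=> /eqP f0 /eqP g0; rewrite linearP /= f0 g0 scaler0 addr0.
Qed.

HB.instance Definition _ := GRing.isSubmodClosed.Build R (freemod R M) fm_ker
  (GRing.submod_closed_semi fm_ker_submod).

Definition syzygy : lmodType R := submod fm_ker.

End FreeCover.

(* [... -> F (K (K M)) -> F (K M) -> F M -> M -> 0], where [F] is the free module
   on the underlying set and [K M] is the kernel of [F M -> M]. *)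
Fixpoint syzygies (R : comPzRingType) (M : lmodType R) (i : nat) : lmodType R :=
  if i is j.+1 then syzygy (syzygies M j) else M.

Section FreeResolution.
Variables (R : comPzRingType) (M : lmodType R).

Definition free_res (i : nat) : lmodType R := freemod R (syzygies M i).

Definition free_res_diff (i : nat) (x : free_res i.+1) : free_res i :=
  val (fm_eval x : syzygies M i.+1).

Lemma free_res_diff_linear i : linear (@free_res_diff i).
Proof. by move=> a x y; rewrite /free_res_diff !linearP. Qed.

HB.instance Definition _ i :=
  GRing.isLinear.Build R (free_res i.+1) (free_res i) *:%R
    (@free_res_diff i) (@free_res_diff_linear i).

Definition free_res_d (i : nat) : {linear free_res i.+1 -> free_res i} :=
  @free_res_diff i.

Definition free_res_aug : {linear free_res 0 -> M} := @fm_eval R M.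

Lemma free_res_aug_surj m : exists x, free_res_aug x = m.
Proof. exact: fm_eval_surj. Qed.

Lemma free_res_exact0 x : free_res_aug x = 0 <-> exists y, free_res_d 0 y = x.
Proof.
split=> [x0|[y <-]]; last exact: (eqP (valP (fm_eval y))).
have kx : x \in @fm_ker R M by apply/eqP.
by have [y yx] := fm_eval_surj (Submod kx : syzygy M); exists y;
  rewrite /= /free_res_diff yx.
Qed.

Lemma free_res_exact i x :
  free_res_d i x = 0 <-> exists y, free_res_d i.+1 y = x.
Proof.
have -> : (free_res_d i x = 0) <-> (fm_eval x = 0).
  by split=> [h|h]; [apply: val_inj|rewrite /= /free_res_diff h].
split=> [x0|[y <-]]; last exact: (eqP (valP (fm_eval y))).
have kx : x \in @fm_ker R (syzygies M i.+1) by apply/eqP.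
by have [y yx] := fm_eval_surj (Submod kx : syzygy _); exists y;
  rewrite /= /free_res_diff yx.
Qed.

End FreeResolution.

(** * Ext *)

(* The cohomology of [0 -> Hom (P 0, N) -> Hom (P 1, N) -> ...]. *)
Section HomCohomology.
Variables (R : comPzRingType) (P : nat -> lmodType R).
Variables (d : forall i, {linear P i.+1 -> P i}) (N : lmodType R).

Definition hom_cocycle (i : nat) : {pred P i -> N} :=
  fun f => `[< linear f /\ forall x, f (d i x) = 0 >].

Definition hom_coboundary (i : nat) : {pred P i -> N} :=
  if i is j.+1 return {pred P i -> N}
  then fun f => `[< exists g : {linear P j -> N}, f = g \o d j >]
  else pred1 0.

Arguments hom_cocycle : clear implicits.
Arguments hom_coboundary : clear implicits.

Lemma hom_cocycle_submod i : submod_closed (hom_cocycle i).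
Proof.
split=> [|a f g /asboolP[fl f0] /asboolP[gl g0]]; apply/asboolP; split.
- by move=> a u v; rewrite scaler0 addr0.
- by [].
- move=> b u v; rewrite !fctE fl gl !scalerDr !scalerA addrACA.
  by rewrite [a * b]mulrC.
- by move=> x; rewrite !fctE f0 g0 scaler0 addr0.
Qed.

HB.instance Definition _ i := GRing.isSubmodClosed.Build R (P i -> N)
  (hom_cocycle i) (GRing.submod_closed_semi (hom_cocycle_submod i)).

Lemma hom_coboundary_submod i : submod_closed (hom_coboundary i).
Proof.
case: i => [|i] /=.
  split=> [|a f g /eqP-> /eqP->]; first exact: eqxx.
  by rewrite scaler0 addr0; exact: eqxx.
split=> [|a f g /asboolP[u ->] /asboolP[v ->]]; apply/asboolP.
  by exists \0.
by exists (a \*: u \+ v).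
Qed.

Definition hom_coboundary_in i : {pred submod (hom_cocycle i)} :=
  fun z => val z \in hom_coboundary i.

Arguments hom_coboundary_in : clear implicits.

Lemma hom_coboundary_in_submod i : submod_closed (hom_coboundary_in i).
Proof.
have [B0 BP] := hom_coboundary_submod i.
split=> [|a f g Bf Bg]; rewrite unfold_in /hom_coboundary_in.
  by rewrite linear0.
by rewrite linearP; exact: BP.
Qed.

HB.instance Definition _ i :=
  GRing.isSubmodClosed.Build R (submod (hom_cocycle i)) (hom_coboundary_in i)
    (GRing.submod_closed_semi (hom_coboundary_in_submod i)).

Definition hom_cohomology (i : nat) : lmodType R :=
  quotmod (hom_coboundary_in i).

End HomCohomology.

Arguments hom_cocycle {R P} d N i _.
Arguments hom_coboundary {R P} d N i _.
Arguments hom_coboundary_in {R P} d N i _.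

Definition Ext (R : comPzRingType) (i : nat) (M N : lmodType R) : lmodType R :=
  hom_cohomology (@free_res_d R M) N i.

(* Main.v *)
(* For a multiplicative set T, say that Ext^i(M, N) is T-torsion if every class is
   killed by an element of T. By devissage both implications reduce to cyclic modules
   R/J, and Noetherian induction on J reduces these to J = q prime, with R/J' already
   known for all larger ideals J'.

   (2) => (1): take T = R \ p and n with Ext^i(R/p, N) = 0 for i > n. If q is strictly
   contained in p and x is in p \ q, the induction hypothesis for R/(q + x) makes
   multiplication by x surjective on Ext^i(R/q, N) up to T-torsion, so Nakayama's
   lemma makes Ext^i(R/q, N) T-torsion for i > n. Hence Ext_R^i(R/J, N_p) = 0 for i > n
   and all J, and the n-th cosyzygy of N_p is injective by Baer's criterion.

   (1) => (2): Ext^i(R/q, N) localized at q vanishes for i > n, but the difficulty is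
   to find one s outside q such that Ext^i(R/q, N) is s-power torsion for all i > n.
   Let q be generated by r elements. The homology modules of the Koszul complex on these
   generators are finite and killed by q, hence, after inverting some s, built from
   R/q. So if Ext^i(R/q, N) is s-power torsion in r + 1 consecutive degrees, it is in
   all later degrees; finitely many degrees are handled by a single s. Finally
   Ext^i(R/(q + s), N) = 0 for large i by induction, so that multiplication by s is
   injective on Ext^i(R/q, N), which therefore vanishes for large i. *)

Require Import Defs.
From HB Require Import structures.
From mathcomp Require Import all_boot all_order all_algebra.
From mathcomp Require Import finmap perm generic_quotient.
From mathcomp Require Import boolp classical_sets functions cardinality fsbigop.
From mathcomp Require Import ring.
Set Implicit Arguments.
Unset Strict Implicit.
Unset Printing Implicit Defensive.

Import GRing.Theory.

Local Open Scope classical_set_scope.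
Local Open Scope ring_scope.

(** * Linear maps, submodules and quotients *)

Section LinearMaps.
Variable R : comPzRingType.
Implicit Types U V W : lmodType R.

Lemma linear_of U V (f : U -> V) : linear f -> exists g : {linear U -> V}, g =1 f.
Proof.
move=> fl; pose m := GRing.isLinear.Build R U V *:%R f fl.
by exists (HB.pack_for {linear U -> V} f m).
Qed.

Definition submodule V (P : set V) : Prop :=
  P 0 /\ forall a x y, P x -> P y -> P (a *: x + y).

Section SubmoduleTheory.
Variables (V : lmodType R) (P : set V).
Hypothesis mP : submodule P.

Lemma submodule0 : P 0. Proof. by case: mP. Qed.

Lemma submoduleZ a x : P x -> P (a *: x).
Proof. by case: mP => P0 Pl Px; rewrite -[_ *: _]addr0; exact: Pl. Qed.

Lemma submoduleD x y : P x -> P y -> P (x + y).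
Proof. by case: mP => P0 Pl Px Py; rewrite -[x]scale1r; exact: Pl. Qed.

Lemma submoduleN x : P x -> P (- x).
Proof. by move=> Px; rewrite -scaleN1r; exact: submoduleZ. Qed.

Lemma submoduleB x y : P x -> P y -> P (x - y).
Proof. by move=> Px Py; apply: submoduleD => //; exact: submoduleN. Qed.

Lemma submodule_sum n (c : 'I_n -> R) (g : 'I_n -> V) :
  (forall i, P (g i)) -> P (\sum_i c i *: g i).
Proof.
move=> Pg; apply: (big_ind P) => [|x y|i _]; first exact: submodule0.
  exact: submoduleD.
exact: submoduleZ.
Qed.

Lemma submodule_mod_closed : submod_closed (fun x => `[< P x >] : bool).
Proof.
case: mP => P0 Pl; split; first exact/asboolP.
by move=> a x y /asboolP Px /asboolP Py; apply/asboolP; exact: Pl.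
Qed.

(** Bridge from [Prop]-valued sets to the boolean predicates over which [submod] and [quotmod] are
    built. *)
Definition submodule_closed : submodClosed V :=
  HB.pack_for (submodClosed V) (fun x => `[< P x >] : bool)
    (GRing.isSubmodClosed.Build R V (fun x => `[< P x >] : bool)
      (GRing.submod_closed_semi submodule_mod_closed)).

Lemma submodule_closedE x : (x \in submodule_closed) = `[< P x >].
Proof. by []. Qed.

Lemma submodule_embedding : exists (S : lmodType R) (i : {linear S -> V}),
  injective i /\ forall x, P x <-> exists s, i s = x.
Proof.
exists (submod submodule_closed), (val : submod submodule_closed -> V).
split=> [|x]; first exact: val_inj.
split=> [Px|[s <-]]; last by have /asboolP := valP s.
have xS : x \in submodule_closed by apply/asboolP.
by exists (Submod xS).
Qed.

Lemma submodule_quotient : exists (Q : lmodType R) (q : {linear V -> Q}),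
  (forall y, exists x, q x = y) /\ forall x, q x = 0 <-> P x.
Proof.
have pl : linear (@quotmod_pi R V submodule_closed : V -> quotmod submodule_closed).
  by move=> a x y; rewrite quotmod_piD quotmod_piZ.
have [q qE] := linear_of pl.
exists (quotmod submodule_closed), q; split=> [y|x].
  by exists (repr (y : Quotient.quot (quotmod_pred submodule_closed)));
    rewrite qE quotmod_piK.
rewrite -(linear0 q) !qE quotmod_piP subr0.
by rewrite submodule_closedE; split=> /asboolP.
Qed.

End SubmoduleTheory.

Lemma kernel_submodule U V (f : {linear U -> V}) : submodule [set x | f x = 0].
Proof.
split=> [|a x y /= fx fy] /=; first exact: linear0.
by rewrite linearP fx fy scaler0 addr0.
Qed.

Lemma range_submodule U V (f : {linear U -> V}) :
  submodule [set y | exists x, f x = y].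
Proof.
split=> [|a _ _ [x <-] [y <-]] /=; first by exists 0; rewrite linear0.
by exists (a *: x + y); rewrite linearP.
Qed.

Definition short_exact U V W (i : {linear U -> V}) (q : {linear V -> W}) : Prop :=
  [/\ injective i, forall z, exists y, q y = z &
      forall y, q y = 0 <-> exists x, i x = y].

Lemma short_exact_comp0 U V W (i : {linear U -> V}) (q : {linear V -> W}) :
  short_exact i q -> forall x, q (i x) = 0.
Proof. by case=> _ _ e x; apply/e; exists x. Qed.

Lemma kernel_short_exact V W (q : {linear V -> W}) :
  (forall z, exists y, q y = z) ->
  exists (U : lmodType R) (i : {linear U -> V}), short_exact i q.
Proof.
move=> qs; have [U [i [ii iE]]] := submodule_embedding (kernel_submodule q).
by exists U, i; split=> // y; exact: iE.
Qed.

Lemma cokernel_short_exact U V (i : {linear U -> V}) : injective i ->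
  exists (W : lmodType R) (q : {linear V -> W}), short_exact i q.
Proof.
move=> ii; have [W [q [qs qE]]] := submodule_quotient (range_submodule i).
by exists W, q; split=> // y; exact: qE.
Qed.

Lemma linear_inj U V (f : {linear U -> V}) :
  (forall x, f x = 0 -> x = 0) -> injective f.
Proof.
by move=> f0 x y fxy; apply/subr0_eq/f0; rewrite linearB fxy subrr.
Qed.

(** A pointwise section [s] of [q] need not be linear, but [f \o s] is: two preimages of a point
    differ by an element of the kernel of [q], on which [f] vanishes. *)
Lemma linear_descend U V W (q : {linear U -> V}) (f : {linear U -> W}) :
  (forall y, exists x, q x = y) -> (forall x, q x = 0 -> f x = 0) ->
  exists g : {linear V -> W}, forall x, g (q x) = f x.
Proof.
move=> qs qf; pose s y := projT1 (cid (qs y)).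
have sK y : q (s y) = y by rewrite /s; case: cid.
have fE x : f (s (q x)) = f x.
  by apply/subr0_eq; rewrite -linearB qf // linearB sK subrr.
have fl : linear (f \o s).
  by move=> a x y /=; rewrite -linearP -[RHS]fE linearP !sK.
by have [g gE] := linear_of fl; exists g => x; rewrite gE /= fE.
Qed.

Lemma linear_lift U V W (i : {linear V -> W}) (f : {linear U -> W}) :
  injective i -> (forall x, exists y, i y = f x) ->
  exists g : {linear U -> V}, forall x, i (g x) = f x.
Proof.
move=> ii fi; pose s x := projT1 (cid (fi x)).
have sE x : i (s x) = f x by rewrite /s; case: cid.
have sl : linear s by move=> a x y; apply: ii; rewrite sE !linearP !sE.
by have [g gE] := linear_of sl; exists g => x; rewrite gE.
Qed.

(** Only the values of [f] have to lie in the range of [q]. This is equivalent to lifting along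
    surjections and applies directly to a differential whose range is a kernel. *)
Definition projective_module (P : lmodType R) : Prop :=
  forall U V (q : {linear U -> V}) (f : {linear P -> V}),
    (forall x, exists u, q u = f x) -> exists g : {linear P -> U}, forall x, q (g x) = f x.

End LinearMaps.

(** * Finitely generated submodules over a Noetherian ring *)

Section Noetherian.
Variable R : comPzRingType.
Implicit Types V : lmodType R.

Definition span V n (g : 'I_n -> V) : set V :=
  [set x | exists c : 'I_n -> R, x = \sum_i c i *: g i].

Lemma span_submodule V n (g : 'I_n -> V) : submodule (span g).
Proof.
split=> [|a _ _ [c ->] [d ->]].
  by exists (fun=> 0); rewrite big1 // => i _; rewrite scale0r.
exists (fun i => a * c i + d i); rewrite scaler_sumr -big_split /=.
by apply: eq_bigr => i _; rewrite scalerDl scalerA.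
Qed.

Lemma span_cat V m n (g : 'I_m -> V) (h : 'I_n -> V) :
  exists k : 'I_(m + n) -> V,
    (forall P : set V, (forall i, P (g i)) -> (forall i, P (h i)) -> forall i, P (k i)) /\
    forall x y, span g x -> span h y -> span k (x + y).
Proof.
exists (fun i => match fintype.split i with inl j => g j | inr j => h j end).
split=> [P Pg Ph i|_ _ [c ->] [d ->]]; first by case: (fintype.split i).
exists (fun i => match fintype.split i with inl j => c j | inr j => d j end).
by rewrite big_split_ord /=; congr (_ + _); apply: eq_bigr => j _;
  [rewrite (unsplitK (inl j))|rewrite (unsplitK (inr j))].
Qed.

Definition finitely_generated V (P : set V) : Prop :=
  exists n (g : 'I_n -> V), (forall i, P (g i)) /\ P `<=` span g.

Lemma noetherian_ideal : noetherian R ->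
  forall J : set R^o, submodule J -> finitely_generated J.
Proof.
move=> Rn J mJ; have [n [g gE]] := Rn (submodule_closed mJ).
exists n, (fun i => val (g i)); split=> [i|x Jx].
  by have /asboolP := valP (g i).
have xJ : x \in submodule_closed mJ by apply/asboolP.
have [c xE] := gE (Submod xJ).
exists c; rewrite -[LHS]/(val (Submod xJ)) xE (linear_sum val).
by apply: eq_bigr => i _; rewrite linearZ.
Qed.

(** Induction on the number of generators. The coefficients of [g ord0] in elements of [P] form an
    ideal [J]; lifts to [P] of finitely many generators of [J], together with generators of the
    intersection of [P] with the span of the other [g i], generate [P]. *)
Lemma noetherian_span : noetherian R ->
  forall V n (g : 'I_n -> V) (P : set V), submodule P -> P `<=` span g ->
  finitely_generated P.
Proof.
move=> Rn V; elim=> [|n IHn] g P mP Pg.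
  by exists 0%N, g; split=> // -[].
pose g' i := g (lift ord0 i).
pose J : set R^o := [set a | exists x, P x /\ span g' (x - a *: g ord0)].
have mJ : submodule J.
  split=> [|a b c [x [Px xg]] [y [Py yg]]].
    exists 0; split; first exact: submodule0.
    by rewrite scale0r subr0; exact: (submodule0 (span_submodule g')).
  exists (a *: x + y); split; first by case: mP => _; apply.
  have -> : a *: x + y - (a *: b + c) *: g ord0 =
            a *: (x - b *: g ord0) + (y - c *: g ord0).
    by rewrite scalerBr scalerDl scalerA opprD addrACA.
  by case: (span_submodule g') => _; apply.
have [m [a [Ja Jspan]]] := noetherian_ideal Rn mJ.
have [x xE] := choice Ja.
have [k [y [Qy Qspan]]] : finitely_generated (P `&` span g').
  apply: (IHn g') => [|z []//]; have [P0 Pl] := mP.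
  have [S0 Sl] := span_submodule g'.
  by split=> // b u v [Pu Su] [Pv Sv]; split; [exact: Pl|exact: Sl].
have [w [wP wspan]] := span_cat x y.
exists (m + k)%N, w; split=> [|z Pz].
  by apply: wP => j; [case: (xE j)|case: (Qy j)].
have [c zE] := Pg z Pz.
have [|d dE] := Jspan (c ord0).
  exists z; split=> //; exists (fun i => c (lift ord0 i)).
  by rewrite zE big_ord_recl /= addrC addKr.
rewrite -[z](subrK (\sum_j d j *: x j)) addrC; apply: wspan; first by exists d.
apply: Qspan; split.
  by apply: submoduleB => //; apply: submodule_sum => // j; case: (xE j).
have -> : z - \sum_j d j *: x j =
   (\sum_i c (lift ord0 i) *: g' i) - \sum_j d j *: (x j - a j *: g ord0).
  rewrite [X in _ = _ - X](eq_bigr (fun j => d j *: x j - (d j *: a j) *: g ord0)); last first.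
    by move=> j _; rewrite scalerBr scalerA.
  rewrite sumrB -scaler_suml -dE opprB addrA zE big_ord_recl.
  by congr (_ - _); rewrite addrC.
apply: submoduleB; first exact: span_submodule.
  by exists (fun i => c (lift ord0 i)).
apply: submodule_sum => [|j]; first exact: span_submodule.
by case: (xE j).
Qed.

End Noetherian.

(** * Free and finite modules, finite presentations, Noetherian induction *)

Section FiniteModules.
Variable R : comPzRingType.
Implicit Types U V W M : lmodType R.

(** Freeness by universal property: the first clause gives uniqueness of maps out of [P], the second
    existence. *)
Definition basis_of (P : lmodType R) n (e : 'I_n -> P) : Prop :=
  (forall x : P, span e x) /\
  forall V (g : 'I_n -> V), exists f : {linear P -> V}, forall i, f (e i) = g i.

Lemma pair_linE U V a (v w : U) (y z : V) :
  a *: (v, y) + (w, z) = (a *: v + w, a *: y + z).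
Proof. by []. Qed.

Lemma basis_exists n : exists (P : lmodType R) (e : 'I_n -> P), basis_of e.
Proof.
pose e (i : 'I_n) : 'I_n -> R^o := fun j => (i == j)%:R.
have eE (c : 'I_n -> R) : \sum_i c i *: e i = c.
  apply/funext => j; rewrite fct_sumE (bigD1 j) //= big1 => [|i /negPf ij].
    by rewrite addr0 /e fctE eqxx; exact: mulr1.
  by rewrite /e fctE ij; exact: mulr0.
exists (('I_n -> R^o) : lmodType R), e; split=> [x|V g].
  by exists x; rewrite eE.
have fl : linear (fun x : 'I_n -> R^o => \sum_i (x i : R) *: g i).
  move=> a x y; rewrite scaler_sumr -big_split /=.
  by apply: eq_bigr => i _; rewrite !fctE scalerDl scalerA.
have [f fE] := linear_of fl; exists f => i; rewrite fE (bigD1 i) //=.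
rewrite /e eqxx scale1r big1 ?addr0 // => j; rewrite eq_sym => /negPf ->.
by rewrite scale0r.
Qed.

Lemma linear_span U V n (e : 'I_n -> U) (f g : {linear U -> V}) x :
  (forall i, f (e i) = g (e i)) -> span e x -> f x = g x.
Proof.
move=> fg [c ->]; rewrite !linear_sum; apply: eq_bigr => i _.
by rewrite !linearZ fg.
Qed.

Lemma basis_projective (P : lmodType R) n (e : 'I_n -> P) : basis_of e -> projective_module P.
Proof.
move=> [eP eu] U V q f fq; have [u uE] := choice (fun i => fq (e i)).
have [g gE] := eu U u; exists g => x.
by apply: (linear_span (f := q \o g)) (eP x) => i /=; rewrite gE.
Qed.

Lemma finite_module_image U V (q : {linear U -> V}) :
  (forall y, exists x, q x = y) -> finite_module U -> finite_module V.
Proof.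
move=> qs [n [g gE]]; exists n, (q \o g) => y.
have [x <-] := qs y; have [c ->] := gE x; exists c.
by rewrite linear_sum; apply: eq_bigr => i _; rewrite linearZ.
Qed.

Lemma finite_module_ext U V W (i : {linear U -> V}) (q : {linear V -> W}) :
  short_exact i q -> finite_module U -> finite_module W -> finite_module V.
Proof.
move=> [_ qs ex] [m [g gE]] [n [h hE]].
have /choice [k kE] := fun j => qs (h j).
have [w [_ wspan]] := span_cat (i \o g) k.
exists (m + n)%N, w => y; have [c qy] := hE (q y).
have [|x xE] := (ex (y - \sum_j c j *: k j)).1.
  rewrite linearB qy linear_sum; apply/eqP; rewrite subr_eq0; apply/eqP.
  by apply: eq_bigr => j _; rewrite linearZ kE.
rewrite -[y](subrK (\sum_j c j *: k j)) -xE; apply: wspan; last by exists c.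
have [b ->] := gE x; exists b; rewrite linear_sum.
by apply: eq_bigr => j _; rewrite linearZ.
Qed.

Lemma prod_short_exact U V : exists (i : {linear U -> (U * V)%type})
  (q : {linear (U * V)%type -> V}),
  [/\ short_exact i q, forall u, i u = (u, 0) & forall w, q w = w.2].
Proof.
have [|i iE] := @linear_of R U (U * V)%type (fun u => (u, 0)).
  by move=> a x y; rewrite pair_linE scaler0 addr0.
have [q qE] := @linear_of R (U * V)%type V snd (fun a x y => erefl).
exists i, q; split=> //; split=> [x y|z|[u v]].
- by rewrite !iE => -[].
- by exists (0, z); rewrite qE.
- rewrite qE /=; split=> [->|[x]]; first by exists u; rewrite iE.
  by rewrite iE => -[].
Qed.

Lemma finite_module_prod U V :
  finite_module U -> finite_module V -> finite_module (U * V)%type.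
Proof.
have [i [q [iq _ _]]] := prod_short_exact U V; exact: finite_module_ext iq.
Qed.

Lemma finite_module_fun V n : finite_module V ->
  finite_module (('I_n -> V) : lmodType R).
Proof.
move=> Vf; elim: n => [|n IHn].
  exists 0%N, (fun=> 0) => x; exists (fun=> 0); apply/funext.
  by case.
have [|q qE] := @linear_of R (V * ('I_n -> V))%type ('I_n.+1 -> V)
  (fun w i => if unlift ord0 i is Some j then w.2 j else w.1).
  move=> a x y; apply/funext => i.
  transitivity (a *: (if unlift ord0 i is Some j then x.2 j else x.1) +
    (if unlift ord0 i is Some j then y.2 j else y.1)); last by [].
  by case: unlift.
apply: (finite_module_image (q := q)); last exact: finite_module_prod.
move=> y; exists (y ord0, fun j => y (lift ord0 j)); rewrite qE.
by apply/funext => i; case: unliftP => [j|] ->.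
Qed.

Hypothesis Rn : noetherian R.

Lemma finite_module_sub U V (i : {linear U -> V}) :
  injective i -> finite_module V -> finite_module U.
Proof.
move=> ii [n [g gE]].
have [|m [h [hi hE]]] := noetherian_span Rn (g := g) (range_submodule i).
  by move=> x _; exact: gE.
have [k kE] := choice hi; exists m, k => x.
have [|c xE] := hE (i x); first by exists x.
exists c; apply: ii; rewrite xE linear_sum; apply: eq_bigr => j _.
by rewrite linearZ kE.
Qed.

Lemma finite_presentation M n (g : 'I_n -> M) : (forall x, span g x) ->
  exists (P : lmodType R) (e : 'I_n -> P) (K : lmodType R)
    (i : {linear K -> P}) (q : {linear P -> M}),
  [/\ basis_of e, short_exact i q, finite_module K & forall j, q (e j) = g j].
Proof.
move=> gM; have [P [e eB]] := basis_exists n; have [eP eu] := eB.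
have [q qE] := eu M g.
have [|K [i iq]] := @kernel_short_exact R P M q.
  move=> x; have [c ->] := gM x; exists (\sum_i c i *: e i).
  by rewrite linear_sum; apply: eq_bigr => j _; rewrite linearZ qE.
exists P, e, K, i, q; split=> //; case: iq => ii _ _.
by apply: (finite_module_sub ii); exists n, e.
Qed.

(** Zorn's lemma gives a maximal counterexample, to which [step] applies: the union of a chain of
    ideals is finitely generated, hence equal to one of its members. *)
Lemma noetherian_ideal_ind (Phi : set R^o -> Prop) :
  (forall J, submodule J ->
     (forall J', submodule J' -> J `<` J' -> Phi J') -> Phi J) ->
  forall J, submodule J -> Phi J.
Proof.
move=> step J0 mJ0; apply: contrapT => nPhi.
pose P (X : set R^o) := X = set0 \/ submodule X /\ ~ Phi X.
have [|A [PA Amax]] := @Zorn_bigcup R^o P.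
  move=> F FP Ft; have [[X [FX X0]]|nF] := pselect (exists X, F X /\ X !=set0); last first.
    left; apply/seteqP; split=> // x [X FX Xx]; exfalso; apply: nF.
    by exists X; split=> //; exists x.
  have sub Y y : F Y -> Y y -> submodule Y /\ ~ Phi Y.
    by move=> FY Yy; case: (FP Y FY) => // Y0; move: Yy; rewrite Y0.
  have mU : submodule (\bigcup_(Y in F) Y).
    split.
      by case: X0 => x Xx; exists X => //; have [/submodule0] := sub X x FX Xx.
    move=> a x y [Y FY Yx] [Z FZ Zy].
    have [mY _] := sub _ _ FY Yx; have [mZ _] := sub _ _ FZ Zy.
    case: (Ft _ _ FY FZ) => [YZ|ZY].
      by exists Z => //; case: mZ => _; apply=> //; exact: YZ.
    by exists Y => //; case: mY => _; apply=> //; exact: ZY.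
  right; have [n [g [gU Ug]]] := noetherian_ideal Rn mU.
  (* All generators lie in one member [Y]; the point [y] ensures that [Y] is an ideal and not the
     empty set. *)
  suff [Y [y [FY Yy gY]]] : exists Y y, [/\ F Y, Y y & forall i, Y (g i)].
    have [mY nY] := sub _ _ FY Yy.
    suff -> : \bigcup_(Y in F) Y = Y by [].
    apply/seteqP; split=> z; last by exists Y.
    by move=> /Ug [c ->]; exact: submodule_sum.
  case: X0 => x Xx.
  elim: n g gU {Ug} => [|n IHn] g gU; first by exists X, x; split=> // -[].
  have [Y [y [FY Yy gY]]] := IHn (fun i => g (lift ord0 i)) (fun i => gU _).
  have [Z FZ gZ] := gU ord0.
  case: (Ft _ _ FY FZ) => [YZ|ZY].
    exists Z, y; split=> // [|i]; first exact: YZ.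
    by case: (unliftP ord0 i) => [j ->|->] //; apply: YZ.
  exists Y, y; split=> // i.
  by case: (unliftP ord0 i) => [j ->|->] //; apply: ZY.
case: PA => [A0|[mA nA]].
  apply: (Amax J0); last by right.
  by rewrite A0; split=> // /(_ 0 (submodule0 mJ0)).
apply: nA; apply: step => // J' mJ' AJ'; apply: contrapT => nJ'.
by apply: (Amax J' AJ'); right.
Qed.

End FiniteModules.

(** * Injective modules *)

Section Baer.
Variable R : comPzRingType.
Implicit Types U V I : lmodType R.

(** [f] is total on [R] but constrained and used only on [J], which avoids a type of elements of
    [J]. *)
Definition baer I : Prop := forall J : set R^o, submodule J ->
  forall f : R -> I,
  (forall a b c, J b -> J c -> f (a * b + c) = a *: f b + f c) ->
  exists z, forall a, J a -> f a = a *: z.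

Section BaerExtend.
Variables (I V : lmodType R).
Hypothesis bI : baer I.

(** The graph of a linear map from a submodule of [V] to [I]; for a submodule, single-valuedness can
    be tested at 0. *)
Definition partial_graph (G : set (V * I)) : Prop :=
  submodule G /\ forall y, G (0, y) -> y = 0.

Lemma partial_graph_fun G v y z : partial_graph G -> G (v, y) -> G (v, z) -> y = z.
Proof.
move=> [mG G0] Gy Gz; apply/subr0_eq/G0.
by have := submoduleB mG Gy Gz; rewrite -[(v, y) - _]/(v - v, y - z) subrr.
Qed.

(** The [a] with [a *: v] in the domain form an ideal [J]. Baer's criterion provides [z] such that
    [a *: v] has value [a *: z] for [a] in [J], so [v] may be sent to [z]. *)
Lemma partial_graph_extend G v : partial_graph G ->
  exists G', [/\ partial_graph G', G `<=` G' & exists y, G' (v, y)].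
Proof.
move=> pG; have [mG G0] := pG; have [_ Gl] := mG.
pose J : set R^o := [set a | exists y, G (a *: v, y)].
have mJ : submodule J.
  split=> [|a b c [y Gy] [z Gz]]; first by exists 0; rewrite scale0r; exact: (submodule0 mG).
  exists (a *: y + z); have := Gl a _ _ Gy Gz.
  by rewrite pair_linE scalerA -scalerDl.
have /choice [f fE] : forall a : R, exists y, J a -> G (a *: v, y).
  move=> a; have [[y Gy]|nJ] := pselect (J a); [by exists y|by exists 0].
have [|z zE] := bI mJ (f := f).
  move=> a b c Jb Jc; have Jabc : J (a * b + c) by case: mJ => _ Jl; exact: (Jl a b c).
  apply: (partial_graph_fun pG (fE _ Jabc)).
  have := Gl a _ _ (fE _ Jb) (fE _ Jc).
  by rewrite pair_linE scalerA -scalerDl.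
pose G' : set (V * I) := [set w | exists a, G (w.1 - a *: v, w.2 - a *: z)].
exists G'; split.
- split=> [|y [a]].
    split=> [|a u w [b Gu] [c Gw]].
      by exists 0; rewrite !scale0r !subr0; exact: (submodule0 mG).
    exists (a * b + c); have := Gl a _ _ Gu Gw.
    rewrite pair_linE !scalerBr !scalerA !scalerDl !opprD.
    by rewrite [_ - _ + (w.1 - _)]addrACA [_ - _ + (w.2 - _)]addrACA.
  rewrite /= sub0r => Ga; have /(submoduleN mG) := Ga.
  rewrite -[- (_, _)]/(- - (a *: v), - (y - a *: z)) opprK opprB => Gb.
  have Ja : J a by eexists; exact: Gb.
  have := partial_graph_fun pG Gb (fE _ Ja); rewrite zE // => /eqP.
  by rewrite subr_eq addrC -subr_eq subrr => /eqP.
- by move=> [x y] Gxy; exists 0; rewrite !scale0r !subr0.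
- by exists z; exists 1; rewrite !scale1r !subrr; exact: (submodule0 mG).
Qed.

(** Zorn's lemma on the partial graphs containing [G0]: a maximal one is total, since it could
    otherwise be extended by one more vector. *)
Lemma baer_extend (G0 : set (V * I)) : partial_graph G0 ->
  exists g : {linear V -> I}, forall v y, G0 (v, y) -> g v = y.
Proof.
move=> pG0; pose P (X : set (V * I)) := X = set0 \/ G0 `<=` X /\ partial_graph X.
have [|A [PA Amax]] := @Zorn_bigcup _ P.
  move=> F FP Ft; have [[X [FX X0]]|nF] := pselect (exists X, F X /\ X !=set0); last first.
    left; apply/seteqP; split=> // x [X FX Xx]; exfalso; apply: nF.
    by exists X; split=> //; exists x.
  have sub Y y : F Y -> Y y -> G0 `<=` Y /\ partial_graph Y.
    by move=> FY Yy; case: (FP Y FY) => // Y0; move: Yy; rewrite Y0.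
  have [x Xx] := X0; have [G0X [mX _]] := sub _ _ FX Xx.
  right; split; first by move=> y /G0X Xy; exists X.
  split; last by move=> y [Y FY Yy]; have [_ [_ Y0]] := sub _ _ FY Yy; exact: Y0.
  split; first by exists X => //; exact: (submodule0 mX).
  move=> a u w [Y FY Yu] [Z FZ Zw].
  have [_ [[_ Yl] _]] := sub _ _ FY Yu; have [_ [[_ Zl] _]] := sub _ _ FZ Zw.
  case: (Ft _ _ FY FZ) => [YZ|ZY].
    by exists Z => //; apply: Zl => //; exact: YZ.
  by exists Y => //; apply: Yl => //; exact: ZY.
have G0_0 : G0 0 by case: pG0 => mG0 _; exact: (submodule0 mG0).
have {PA} [G0A pA] : G0 `<=` A /\ partial_graph A.
  case: PA => // A0; exfalso; apply: (Amax G0); last by right; split.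
  by rewrite A0; split=> // /(_ _ G0_0).
have Atot v : exists y, A (v, y).
  have [G' [pG' AG' [y G'y]]] := partial_graph_extend v pA.
  exists y; apply: contrapT => nA; apply: (Amax G').
    by split=> // /(_ _ G'y).
  by right; split=> //; exact: subset_trans AG'.
have [f fE] := choice Atot.
have fl : linear f.
  move=> a x y; apply: (partial_graph_fun pA (fE _)).
  by case: pA => -[_ Al] _; exact: (Al a _ _ (fE x) (fE y)).
have [g gE] := linear_of fl; exists g => v y /G0A Ay.
by rewrite gE; exact: (partial_graph_fun pA (fE v) Ay).
Qed.

End BaerExtend.

Lemma baer_injective I : baer I -> injective_module I.
Proof.
move=> bI U V i f ii.
have [|g gE] := @baer_extend I V bI [set w | exists x, w = (i x, f x)].
  split=> [|y [x []]]; first split=> [|a u w [x ->] [y ->]].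
  - by exists 0; rewrite !linear0.
  - by exists (a *: x + y); rewrite !linearP.
  - by rewrite -[X in X = i x](linear0 i) => /ii <- ->; rewrite linear0.
by exists g => x; apply: gE; exists x.
Qed.

End Baer.

(** * Q/Z as an injective cogenerator of abelian groups *)

Section InjectiveEmbedding.

Definition rat_int : set (zmodule rat) := [set x | exists n : int, x = n%:~R].

Lemma rat_int_submodule : submodule rat_int.
Proof.
split=> [|a x y [n ->] [k ->]]; first by exists 0.
by exists (n * a + k); rewrite intrD mulrzA.
Qed.

Definition ratmodint : lmodType int := quotmod (submodule_closed rat_int_submodule).
Definition ratmodint_pi : zmodule rat -> ratmodint :=
  @quotmod_pi _ _ (submodule_closed rat_int_submodule).

Lemma ratmodint_pi0 x : ratmodint_pi x = 0 <-> exists n : int, x = n%:~R.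
Proof.
have -> : 0 = ratmodint_pi 0.
  by apply: (addIr (ratmodint_pi 0)); rewrite add0r -quotmod_piD addr0.
by rewrite quotmod_piP subr0 submodule_closedE; split=> /asboolP.
Qed.

Lemma int_ideal (J : set int^o) : submodule J ->
  exists m : int, J m /\ forall n, J n -> exists c, n = c * m.
Proof.
move=> mJ; have [[k [k0 Jk]]|nJ] := pselect (exists k : nat, (0 < k)%N /\ J k%:Z); last first.
  exists 0; split; first exact: (submodule0 mJ).
  move=> n Jn; exists 0; rewrite mulr0; apply: contrapT => /eqP n0; apply: nJ.
  exists `|n|%N; rewrite absz_gt0; split=> //.
  by case: (intP n) Jn n0 => // m Jm _; rewrite abszN; have := submoduleN mJ Jm; rewrite opprK.
pose p k := (0 < k)%N && `[< J k%:Z >].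
have exp : exists k, p k by exists k; rewrite /p k0; apply/asboolP.
case: (ex_minnP exp) => m /andP[m0 /asboolP Jm] mmin.
exists m%:Z; split=> // n Jn; exists (n %/ m)%Z.
have Jr : J (n %% m)%Z.
  rewrite /modz -[- _]mulNr addrC.
  by have [_ Jl] := mJ; exact: (Jl (- (n %/ m)%Z) m%:Z n).
have mz : m%:Z != 0 by rewrite -lt0n.
rewrite {1}(divz_eq n m); have [->|r0] := eqVneq (n %% m)%Z 0; first by rewrite addr0.
have rE : (n %% m)%Z = `|(n %% m)%Z|%N :> int by rewrite gez0_abs // modz_ge0.
have : (m <= `|(n %% m)%Z|)%N.
  by apply: mmin; rewrite /p absz_gt0 r0; apply/asboolP; rewrite -rE.
by rewrite leqNgt -ltz_nat -rE ltz_pmod.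
Qed.

Lemma ratmodint_divisible (m : int) (y : ratmodint) : m != 0 ->
  exists z : ratmodint, y = m *: z.
Proof.
move=> m0; have <- := quotmod_piK y.
set x : rat := repr _; exists (ratmodint_pi (x / m%:~R)).
apply: etrans (quotmod_piZ _ m (x / m%:~R : zmodule rat)); congr quotmod_pi.
by rewrite -[RHS]/((x / m%:~R) *~ m) -mulrzr mulfVK // intr_eq0.
Qed.

(** Ideals of the integers are principal, so only the value at a generator has to be divided by that
    generator, and Q/Z is divisible. *)
Lemma ratmodint_baer : baer ratmodint.
Proof.
move=> J mJ f fl; have [m [Jm Jgen]] := int_ideal mJ.
have f0 : f 0 = 0.
  have := fl 1 0 0 (submodule0 mJ) (submodule0 mJ).
  by rewrite mulr0 addr0 scale1r => /eqP; rewrite -subr_eq subrr eq_sym => /eqP.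
have [z zE] : exists z, f m = m *: z.
  have [->|m0] := eqVneq m 0; first by exists 0; rewrite f0 scaler0.
  exact: ratmodint_divisible.
exists z => a /Jgen [c ->].
have := fl c m 0 Jm (submodule0 mJ); rewrite !addr0 f0 addr0 => ->.
by rewrite zE scalerA.
Qed.

Lemma ratmodint_separates (U : lmodType int) (u : U) : u != 0 ->
  exists f : {linear U -> ratmodint}, f u != 0.
Proof.
move=> u0; pose J : set int^o := [set n | n *: u = 0].
have mJ : submodule J.
  split=> [|a b c Jb Jc]; first exact: scale0r.
  by apply: etrans (scalerDl u (a * b) c) _; rewrite -scalerA Jb Jc scaler0 addr0.
have [m [Jm Jgen]] := int_ideal mJ.
(* The annihilator of [u] is generated by [m]; [u] is sent to the class of [1/m]
   (of [1/2] if [m = 0]). *)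
pose k : int := if m == 0 then 2 else m.
have k0 : k != 0 by rewrite /k; case: (eqVneq m 0).
pose y : zmodule rat := (k%:~R : rat)^-1.
have y0 : ratmodint_pi y != 0.
  apply/eqP => /ratmodint_pi0 [n /(congr1 (fun z : rat => z * k%:~R))].
  rewrite mulVf ?intr_eq0 // -intrM => /eqP.
  rewrite -[1]/(1%:~R : rat) eqr_int => /eqP nk.
  move: nk; rewrite /k; case: (eqVneq m 0) => _ nk.
    by have : (2 %| 1)%Z by apply/dvdzP; exists n.
  by move/negP: u0; apply; rewrite -[u]scale1r nk -scalerA Jm scaler0.
have my : m *: ratmodint_pi y = 0.
  apply: etrans (esym (quotmod_piZ _ m y)) _; apply/ratmodint_pi0.
  rewrite /y /k; case: (eqVneq m 0) => [->|m0]; first by exists 0; rewrite scale0r.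
  by exists 1; rewrite scalezrE -mulrzr mulVf // intr_eq0.
have [|g gE] := @baer_extend _ ratmodint U ratmodint_baer
  [set w | exists n, w = (n *: u, n *: ratmodint_pi y)].
  split=> [|z [n [/esym nu ->]]]; first split=> [|a v w [n ->] [l ->]].
  - by exists 0; rewrite !scale0r.
  - by exists (a * n + l); rewrite pair_linE !scalerDl !scalerA.
  - by have [c ->] := Jgen n nu; rewrite -scalerA my scaler0.
exists g; rewrite (gE u (ratmodint_pi y)) //.
by exists 1; rewrite !scale1r.
Qed.

End InjectiveEmbedding.

Lemma additive_int_linear (U V : lmodType int) (f : U -> V) :
  {morph f : x y / x + y} -> linear f.
Proof.
move=> fD a x y; rewrite fD; congr (_ + _).
have f0 : f 0 = 0.
  by have /eqP := fD 0 0; rewrite addr0 -subr_eq subrr eq_sym => /eqP.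
have fN z : f (- z) = - f z.
  by apply/eqP; rewrite -addr_eq0 -fD addNr f0.
have fn n z : f (z *+ n) = f z *+ n.
  by elim: n => [|n IHn]; rewrite ?mulr0n // !mulrS fD IHn.
rewrite -[a]intz !scaler_int; case: (intP a) => [|n|n].
- by rewrite !mulr0z.
- exact: fn.
- by rewrite !mulrNz fN -!pmulrn fn.
Qed.

(** * Coinduced modules and enough injectives *)

Section Coinduced.
Variables (A : comPzRingType) (D : lmodType int).

Definition additive_fun : set (A -> D) := [set f : A -> D | {morph f : x y / x + y}].

Lemma additive_fun_submodule : submodule additive_fun.
Proof.
split=> [x y|a f g fD gD x y]; first exact: (esym (addr0 0)).
apply: etrans (addrACA _ _ _ _).
by rewrite -scalerDr -fD -gD.
Qed.

(** This is Hom_Z(A, D); below, [A] acts on it by multiplication of the argument. *)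
Definition coinduced : Type := submod (submodule_closed additive_fun_submodule).
HB.instance Definition _ := GRing.Zmodule.on coinduced.

Lemma coinducedP (f : A -> D) : {morph f : x y / x + y} ->
  f \in submodule_closed additive_fun_submodule.
Proof. by move=> fD; apply/asboolP. Qed.

Lemma coinducedD (f : coinduced) : {morph val f : x y / x + y}.
Proof. by have /asboolP := valP f. Qed.

Lemma coinduced_scale_subproof (a : A) (f : coinduced) :
  {morph (fun b => val f (b * a)) : x y / x + y}.
Proof. by move=> x y /=; rewrite mulrDl coinducedD. Qed.

Definition coinduced_scale (a : A) (f : coinduced) : coinduced :=
  Submod (coinducedP (@coinduced_scale_subproof a f)).

Lemma coinduced_scaleA a b f :
  coinduced_scale a (coinduced_scale b f) = coinduced_scale (a * b) f.
Proof. by apply: val_inj; apply/funext => c /=; rewrite mulrA. Qed.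

Lemma coinduced_scale1 : left_id 1 coinduced_scale.
Proof. by move=> f; apply: val_inj; apply/funext => c /=; rewrite mulr1. Qed.

Lemma coinduced_scaleDr : right_distributive coinduced_scale +%R.
Proof. by move=> a f g; apply: val_inj; apply/funext => c. Qed.

Lemma coinduced_scaleDl f : {morph coinduced_scale^~ f : a b / a + b}.
Proof.
move=> a b; apply: val_inj; apply/funext => c.
by rewrite /= mulrDr coinducedD.
Qed.

HB.instance Definition _ := GRing.Zmodule_isLmodule.Build A coinduced
  coinduced_scaleA coinduced_scale1 coinduced_scaleDr coinduced_scaleDl.

Lemma coinduced_linear (V : lmodType A) (g : zmodule V -> D) :
  {morph g : x y / x + y} ->
  exists h : {linear V -> coinduced}, forall v a, val (h v) a = g (a *: v).
Proof.
move=> gD; have gP v : {morph (fun a : A => g (a *: v)) : x y / x + y}.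
  by move=> x y /=; rewrite scalerDl gD.
have [|h hE] := @linear_of A V coinduced (fun v => Submod (coinducedP (gP v))).
  move=> a x y; apply: val_inj; apply/funext => b /=.
  by rewrite scalerDr gD scalerA.
by exists h => v a; rewrite hE.
Qed.

(** Adjunction: evaluation at [1] turns a map into [coinduced] into an additive map to [D], which
    extends because [D] is injective over the integers; [coinduced_linear] turns the extension
    back. *)
Lemma coinduced_injective : injective_module D -> injective_module coinduced.
Proof.
move=> iD U V i f ii.
have [i' i'E] : exists i' : {linear zmodule U -> zmodule V}, i' =1 i.
  by apply/linear_of/(@additive_int_linear (zmodule U) (zmodule V)); exact: (raddfD i).
have [f1 f1E] : exists f1 : {linear zmodule U -> D}, f1 =1 (fun u => val (f u) 1).
  apply/linear_of/(@additive_int_linear (zmodule U) D) => u v.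
  by rewrite linearD.
have [|g1 g1E] := iD _ _ i' f1; first by move=> x y; rewrite !i'E => /ii.
have [|g gE] := @coinduced_linear V g1; first exact: raddfD.
exists g => x; apply: val_inj; apply/funext => a.
rewrite gE -linearZ -i'E g1E f1E linearZ /=.
by congr (val (f x) _); rewrite mul1r.
Qed.

End Coinduced.

Lemma fun_injective (R : comPzRingType) (T : Type) (I : lmodType R) :
  injective_module I -> injective_module ((T -> I) : lmodType R).
Proof.
move=> iI U V i f ii.
have /choice [g gE] : forall t, exists g : {linear V -> I}, forall x, g (i x) = f x t.
  move=> t; have [|h hE] := @linear_of R U I (fun x => f x t).
    by move=> a x y; rewrite linearP.
  by have [g gE] := iI U V i h ii; exists g => x; rewrite gE.
have [|h hE] := @linear_of R V (T -> I) (fun v t => g t v).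
  by move=> a x y; apply/funext => t; rewrite linearP.
by exists h => x; apply/funext => t; rewrite hE gE.
Qed.

(** [D] is the product of copies of Q/Z indexed by the additive maps from [U] to Q/Z. These maps
    separate points, and coinduction turns [D] into an injective [R]-module. *)
Lemma enough_injectives (R : comPzRingType) (U : lmodType R) :
  exists (I : lmodType R) (i : {linear U -> I}), injective_module I /\ injective i.
Proof.
pose D : lmodType int := {linear zmodule U -> ratmodint} -> ratmodint.
have [|i iE] := @coinduced_linear R D U (fun u f => f u).
  by move=> x y; apply/funext => f; rewrite raddfD.
exists (coinduced R D), i; split.
  exact/coinduced_injective/fun_injective/baer_injective/ratmodint_baer.
apply: linear_inj => x ix0; apply: contrapT => /eqP x0.
have [f /eqP] := @ratmodint_separates (zmodule U) x x0; apply.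
by have := iE x 1; rewrite ix0 scale1r => /(congr1 (@^~ f)).
Qed.

(** * Injective resolutions *)

Section InjectiveResolution.
Variable A : comPzRingType.
Implicit Types U V N : lmodType A.

(* The embedding is an isomorphism as soon as the source is injective, so that a
   resolution by such embeddings stops as early as it can. *)
Record cosyzygy_data U := CosyzygyData {
  cz_hull : lmodType A;
  cz_quot : lmodType A;
  cz_emb : {linear U -> cz_hull};
  cz_proj : {linear cz_hull -> cz_quot};
  cz_injective : injective_module cz_hull;
  cz_exact : short_exact cz_emb cz_proj;
  cz_tight : injective_module U -> zero_module cz_quot
}.

Lemma cosyzygy_data_exists U : exists c : cosyzygy_data U, True.
Proof.
have [I [i [iI ii tI]]] : exists (I : lmodType A) (i : {linear U -> I}),
    [/\ injective_module I, injective i &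
        injective_module U -> forall y, exists x, i x = y].
  have [iU|nU] := pselect (injective_module U).
    have [i iE] := @linear_of A U U id (fun a x y => erefl).
    exists U, i; split=> // [x y|_ y]; first by rewrite !iE.
    by exists y; rewrite iE.
  by have [I [i [iI ii]]] := enough_injectives U; exists I, i.
have [C [q iq]] := cokernel_short_exact ii.
have tC : injective_module U -> zero_module C.
  move=> /tI si z; have [_ qs _] := iq; have [y <-] := qs z.
  by have [x <-] := si y; exact: (short_exact_comp0 iq).
by exists (CosyzygyData iI iq tC).
Qed.

Definition cosyzygy_of U : cosyzygy_data U := projT1 (cid (cosyzygy_data_exists U)).

Lemma zero_module_injective U : zero_module U -> injective_module U.
Proof.
by move=> U0 V W i f _; exists \0 => x; exact/esym/U0.
Qed.

Variable N : lmodType A.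

Fixpoint cosyzygy n : lmodType A :=
  if n is m.+1 then cz_quot (cosyzygy_of (cosyzygy m)) else N.

Let I n := cz_hull (cosyzygy_of (cosyzygy n)).
Let emb n : {linear cosyzygy n -> I n} := cz_emb (cosyzygy_of (cosyzygy n)).
Let proj n : {linear I n -> cosyzygy n.+1} := cz_proj (cosyzygy_of (cosyzygy n)).

Let IE n : short_exact (emb n) (proj n) := cz_exact (cosyzygy_of (cosyzygy n)).

Let d n : {linear I n -> I n.+1} := emb n.+1 \o proj n.

Let d_ker n x : d n x = 0 <-> exists y, emb n y = x.
Proof.
have [_ _ <-] := IE n; have [ei _ _] := IE n.+1.
by split=> [|e]; [rewrite /d /= -[RHS](linear0 (emb n.+1)) => /ei|rewrite /d /= e linear0].
Qed.

Let d_exact n x : d n.+1 x = 0 <-> exists y, d n y = x.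
Proof.
rewrite d_ker; have [_ ps _] := IE n; split=> -[y <-]; last by exists (proj n y).
by have [z <-] := ps y; exists z.
Qed.

Definition tight_resolution : injective_resolution N :=
  @InjectiveResolution A N I d (emb 0)
    (fun n => @cz_injective _ _) (let: And3 h _ _ := IE 0 in h) (@d_ker 0) d_exact.

(** An injective cosyzygy has a zero successor, and zero modules are injective, so all later
    cosyzygies vanish. Term [i] of the resolution is an extension of cosyzygy [i.+1] by cosyzygy
    [i], hence the strict bound. *)
Lemma tight_resolution_stop n : injective_module (cosyzygy n) ->
  forall i, (n < i)%N -> zero_module (tight_resolution i).
Proof.
move=> iC; have Cz i : (n < i)%N -> zero_module (cosyzygy i).
  elim: i => // i IHi; rewrite ltnS leq_eqVlt => /orP[/eqP <-|ni].
    exact: (cz_tight (c := cosyzygy_of (cosyzygy n))).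
  apply: (cz_tight (c := cosyzygy_of (cosyzygy i))).
  exact/zero_module_injective/IHi.
move=> i ni x; have [_ _ ex] := IE i.
have : proj i x = 0 by apply: Cz; exact: ltnW.
by move=> /ex [y <-]; rewrite (Cz _ ni y) linear0.
Qed.

Lemma tight_resolution_kernel n :
  exists c : {linear cosyzygy n -> tight_resolution n}, injective c /\
    forall x, ires_d tight_resolution n x = 0 <-> exists y, c y = x.
Proof. by exists (emb n); split; [case: (IE n)|exact: d_ker]. Qed.

End InjectiveResolution.

(** * Torsion of Ext computed from an injective resolution *)

Definition multiplicative (R : comPzRingType) (T : set R) : Prop :=
  T 1 /\ forall s t, T s -> T t -> T (s * t).

Section ExtTorsion.
Variables (R : comPzRingType) (N : lmodType R) (I : injective_resolution N).
Implicit Types (A B C M P : lmodType R) (T : set R).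

Local Notation d := (ires_d I).

Definition cocycle i M (f : {linear M -> I i}) : Prop := forall x, d i (f x) = 0.

(* [Ext^(i+1)(M, N)] is [T]-torsion. *)
Definition ext_torsion T i M : Prop :=
  forall f : {linear M -> I i.+1}, cocycle f ->
  exists t, T t /\ exists g : {linear M -> I i}, forall x, t *: f x = d i (g x).

Lemma ires_dd i x : d i.+1 (d i x) = 0.
Proof. by apply/ires_exact; exists x. Qed.

Lemma ext_torsion_projective T i P : multiplicative T -> projective_module P ->
  ext_torsion T i P.
Proof.
move=> [T1 _] pP f f0; exists 1; split=> //.
have [|g gE] := pP _ _ (d i) f; first by move=> x; apply/ires_exact; exact: f0.
by exists g => x; rewrite scale1r gE.
Qed.

Lemma ext_torsion_zero T i M : multiplicative T -> zero_module M ->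
  ext_torsion T i M.
Proof.
move=> mT M0; apply: ext_torsion_projective => // U V q f _.
by exists \0 => x; rewrite (M0 x) !linear0.
Qed.

Lemma ext_torsion_sub T T' i M : T `<=` T' -> ext_torsion T i M ->
  ext_torsion T' i M.
Proof. by move=> TT' h f /h [t [/TT' Tt ht]]; exists t. Qed.

Lemma ext_torsion_kill T i M t : T t -> (forall x : M, t *: x = 0) ->
  ext_torsion T i M.
Proof.
move=> Tt tM f _; exists t; split=> //.
by exists \0 => x; rewrite -linearZ tM !linear0.
Qed.

Section ShortExact.
Variables (A B C : lmodType R) (i : {linear A -> B}) (q : {linear B -> C}).
Hypothesis iq : short_exact i q.
Variables (T : set R) (mT : multiplicative T).

Let ii : injective i. Proof. by case: iq. Qed.
Let qs : forall z, exists y, q y = z. Proof. by case: iq. Qed.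
Let qi x : q (i x) = 0. Proof. exact: short_exact_comp0. Qed.
Let TM s t : T s -> T t -> T (s * t). Proof. by case: mT => _; apply. Qed.

Lemma short_exact_descend M (f : {linear B -> M}) :
  (forall x, f (i x) = 0) -> exists g : {linear C -> M}, forall y, g (q y) = f y.
Proof.
move=> f0; apply: linear_descend => // y.
by have [_ _ ex] := iq => /ex [x <-].
Qed.

Lemma ires_extend n (f : {linear A -> I n}) :
  exists g : {linear B -> I n}, forall x, g (i x) = f x.
Proof. exact: ires_injective. Qed.

(** Exactness of Ext(C) -> Ext(B) -> Ext(A). After multiplication by [t] the restriction of [f] to
    [A] is a coboundary; injectivity of [I n] extends its witness to [B], and the difference
    descends to [C]. *)
Lemma ext_torsion_mid n : ext_torsion T n A -> ext_torsion T n C -> ext_torsion T n B.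
Proof.
move=> hA hC f f0.
have [|t [Tt [g gE]]] := hA (f \o i); first by move=> x /=.
have [h hE] := ires_extend g.
have [|k kE] := @short_exact_descend _ (t \*: f \- (d n \o h)).
  by move=> x /=; rewrite hE -gE subrr.
have [|s [Ts [e eE]]] := hC k.
  move=> z; have [y <-] := qs z.
  by rewrite kE linearB linearZ /= f0 scaler0 ires_dd subrr.
exists (s * t); split; first exact: TM.
exists (s \*: h \+ (e \o q)) => y /=.
rewrite linearD linearZ -eE kE /= -scalerDr addrC subrK scalerA //.
Qed.

(** Exactness of Ext(A) -> Ext(C) -> Ext(B), where the connecting map raises the degree by one. *)
Lemma ext_torsion_quot n :
  ext_torsion T n A -> ext_torsion T n.+1 B -> ext_torsion T n.+1 C.
Proof.
move=> hA hB f f0.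
have [|t [Tt [g gE]]] := hB (f \o q); first by move=> x /=.
have [|s [Ts [h hE]]] := hA (g \o i).
  by move=> x /=; rewrite -gE /= qi linear0 scaler0.
have [e eE] := ires_extend h.
have [|k kE] := @short_exact_descend _ (s \*: g \- (d n \o e)).
  by move=> x /=; rewrite eE -hE subrr.
exists (s * t); split; first exact: TM.
exists k => z; have [y <-] := qs z.
by rewrite kE linearB linearZ /= -gE ires_dd subr0 scalerA.
Qed.

(** Exactness on the other side of the connecting map: Ext(B) -> Ext(A) -> Ext(C). *)
Lemma ext_torsion_subm n :
  ext_torsion T n B -> ext_torsion T n.+1 C -> ext_torsion T n A.
Proof.
move=> hB hC f f0; have [g gE] := ires_extend f.
have [|c cE] := @short_exact_descend _ (d n.+1 \o g).
  by move=> x /=; rewrite gE f0.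
have [|t [Tt [e eE]]] := hC c.
  by move=> z; have [y <-] := qs z; rewrite cE ires_dd.
have [|s [Ts [h hE]]] := hB (t \*: g \- (e \o q)).
  by move=> y; rewrite linearB linearZ /= -eE cE subrr.
exists (s * t); split; first exact: TM.
exists (h \o i) => x; rewrite /= -hE /= gE qi linear0 subr0 scalerA //.
Qed.

Lemma ext_torsion_shift n : projective_module B ->
  ext_torsion T n.+1 C <-> ext_torsion T n A.
Proof.
move=> pB; split=> h; [apply: ext_torsion_subm|apply: ext_torsion_quot] => //;
  exact: ext_torsion_projective.
Qed.

Lemma ires_augK (P : lmodType R) (f : {linear P -> I 0}) :
  cocycle f -> exists g : {linear P -> N}, forall x, ires_aug I (g x) = f x.
Proof.
move=> f0; apply: linear_lift; first exact: ires_aug_inj.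
by move=> x; apply/ires_exact0; exact: f0.
Qed.

Lemma ires_d_aug y : d 0 (ires_aug I y) = 0.
Proof. by apply/ires_exact0; exists y. Qed.

(** For projective [B], Ext^1(C, N) is the cokernel of Hom(B, N) -> Hom(A, N). The right-hand side
    does not mention [I], which makes different computations of Ext comparable. *)
Lemma ext_torsion0P : projective_module B -> ext_torsion T 0 C <->
  forall f : {linear A -> N}, exists t, T t /\
    exists g : {linear B -> N}, forall x, t *: f x = g (i x).
Proof.
move=> pB; split=> [hC f|h c c0].
  have [F FE] := ires_extend (ires_aug I \o f).
  have [|c cE] := @short_exact_descend _ (d 0 \o F).
    by move=> x /=; rewrite FE ires_d_aug.
  have [|t [Tt [g gE]]] := hC c.
    by move=> z; have [y <-] := qs z; rewrite cE ires_dd.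
  have [|e eE] := @ires_augK B (t \*: F \- (g \o q)).
    by move=> y; rewrite linearB linearZ /= -gE cE subrr.
  exists t; split=> //; exists e => x; apply: (@ires_aug_inj _ _ I).
  by rewrite eE /= FE qi linear0 subr0 linearZ.
have [|F FE] := pB _ _ (d 0) (c \o q).
  by move=> y; apply/ires_exact; exact: c0.
have [|f fE] := @ires_augK A (F \o i).
  by move=> x; rewrite /= FE /= qi linear0.
have [t [Tt [e eE]]] := h f.
have [|g gE] := @short_exact_descend _ (t \*: F \- (ires_aug I \o e)).
  by move=> x /=; rewrite -eE linearZ fE subrr.
exists t; split=> //; exists g => z; have [y <-] := qs z.
by rewrite gE linearB linearZ /= ires_d_aug subr0 FE.
Qed.

End ShortExact.

End ExtTorsion.

(** * Comparison with the free resolution *)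

Section FreeResolutionComparison.
Variable R : comPzRingType.

(** The lift is determined by preimages [w s] of the images of the basis vectors [delta s]; finite
    supports make the sum over [S] finite. *)
Lemma freemod_projective (S : choiceType) : projective_module (freemod R S).
Proof.
move=> U V q f fq.
have deltaP s : (fun t => (t == s)%:R : R^o) \in fin_supp R S.
  apply/asboolP; apply: (sub_finite_set _ (finite_set1 s)) => t /=.
  by have [//|_] := eqVneq t s; rewrite eqxx.
pose delta s : freemod R S := Submod (deltaP s).
have /choice [w wE] := fun s => fq (delta s).
pose g (x : freemod R S) : U := \sum_(s \in [set: S]) (val x s : R) *: w s.
have gE (D : set S) x : finite_set D -> (forall s, val x s != 0 -> D s) ->
    g x = \sum_(s \in D) (val x s : R) *: w s.
  move=> Df xD; symmetry; apply: fsbig_widen => // s [_ nDs] /=.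
  by have [->|/xD //] := eqVneq (val x s) 0; rewrite scale0r.
have [h hE] : exists h : {linear freemod R S -> U}, h =1 g.
  apply: linear_of => a x y; have /asboolP fx := valP x; have /asboolP fy := valP y.
  pose D := [set s | val x s != 0] `|` [set s | val y s != 0].
  have Df : finite_set D by rewrite finite_setU.
  rewrite (gE D x) //; last by move=> s ?; left.
  rewrite (gE D y) //; last by move=> s ?; right.
  rewrite (gE D (a *: x + y)) //; last first.
    move=> s; rewrite linearP !fctE /D /=.
    case: (eqVneq (val x s) 0) => [-> |]; last by left.
    case: (eqVneq (val y s) 0) => [-> |]; last by right.
    by rewrite scaler0 addr0 eqxx.
  rewrite !fsbig_finite //= scaler_sumr -big_split /=; apply: eq_bigr => s _.
  by rewrite scalerA -scalerDl.
exists h => x; have /asboolP fx := valP x.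
rewrite hE (gE _ x fx) // fsbig_finite // linear_sum.
under eq_bigr do rewrite linearZ wE /= -linearZ.
rewrite -linear_sum; congr (f _); apply: val_inj; apply/funext => t.
rewrite (linear_sum val) fct_sumE.
under eq_bigr do rewrite linearZ /=.
have [xt|xt] := eqVneq (val x t) 0.
  rewrite big1_seq // => s /= _; rewrite fctE.
  by have [<-|_] := eqVneq t s; [rewrite xt scale0r|rewrite scaler0].
rewrite (bigD1_seq t) /=; last exact: fset_uniq.
  rewrite fctE eqxx big1 => [|s]; first by rewrite addr0; exact: mulr1.
  by rewrite fctE eq_sym => /negPf ->; rewrite scaler0.
by rewrite in_fset_set // inE.
Qed.

Lemma syzygy_short_exact (M : lmodType R) :
  short_exact (val : {linear syzygy M -> freemod R M}) (@fm_eval R M : {linear freemod R M -> M}).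
Proof.
split; first exact: val_inj.
  exact: fm_eval_surj.
move=> y; split=> [y0|[x <-]]; last exact: (eqP (valP x)).
have ky : y \in @fm_ker R M by apply/eqP.
by exists (Submod ky).
Qed.

Lemma multiplicative1 : multiplicative [set (1 : R)].
Proof. by split=> // s t -> ->; rewrite mulr1. Qed.

(** Shifting along the syzygies reduces to Ext^1 of syzygy [i], where [ext_torsion0P] asks that maps
    from syzygy [i.+1] to [N] extend to the free module. Cocycles in degree [i.+1] are such maps
    composed with [fm_eval], and coboundaries are those that extend. *)
Lemma Ext_zeroP (M N : lmodType R) (I : injective_resolution N) i :
  zero_module (Ext i.+1 M N) <-> ext_torsion I [set 1] i M.
Proof.
have shift j : ext_torsion I [set 1] i (syzygies M j) <->
    ext_torsion I [set 1] 0 (syzygies M (i + j)).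
  elim: i j => [|i IHi] j //; rewrite addSnnS -IHi.
  apply: (ext_torsion_shift I (syzygy_short_exact _) multiplicative1).
  exact: freemod_projective.
rewrite -[M in ext_torsion I _ i M]/(syzygies M 0) shift addn0.
rewrite (ext_torsion0P I (syzygy_short_exact _) _ (@freemod_projective _)).
have [_ ps _] := syzygy_short_exact (syzygies M i.+1).
split=> [E0 f|h].
  have fP : (f \o @fm_eval R _ : free_res M i.+1 -> N) \in hom_cocycle (@free_res_d R M) N i.+1.
    apply/asboolP; split=> [a x y|x]; first by rewrite linearP.
    rewrite /= -[RHS](linear0 f); congr (f _).
    exact: (short_exact_comp0 (syzygy_short_exact _)).
  have := E0 (quotmod_pi _ (Submod fP)).
  have p0 : quotmod_pi (hom_coboundary_in (@free_res_d R M) N i.+1) 0 = 0.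
    set z := quotmod_pi _ _.
    by apply: (addIr z); rewrite add0r /z -quotmod_piD addr0.
  rewrite -p0 => /quotmod_piP; rewrite subr0 => /asboolP[g /= gE].
  exists 1; split=> //; exists g => x; have [y <-] := ps x.
  by rewrite scale1r -[LHS]/((f \o @fm_eval R _) y) gE.
move=> x; have <- := quotmod_piK x; set z := repr _.
have p0 : quotmod_pi (hom_coboundary_in (@free_res_d R M) N i.+1) 0 = 0.
  set w := quotmod_pi _ _.
  by apply: (addIr w); rewrite add0r /w -quotmod_piD addr0.
rewrite -p0; apply/quotmod_piP; rewrite subr0.
have /asboolP [zl z0] := valP z; have [z' z'E] := linear_of zl.
have [|f fE] := short_exact_descend (syzygy_short_exact (syzygies M i.+1)) (f := z').
  by move=> u; have [v <-] := fm_eval_surj u; rewrite z'E; exact: z0.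
have [t [-> [g gE]]] := h f.
apply/asboolP; exists g; apply/funext => y.
by rewrite /= -z'E -fE -gE scale1r.
Qed.

End FreeResolutionComparison.

(** * Finiteness of Ext and multiplication maps *)

(** Congruence modulo [x] passes through the sums and products of the Leibniz formula. *)
Lemma det_congr (R : comPzRingType) (x : R) n (A B : 'M[R]_n) :
  (forall i j, exists r, A i j = B i j + x * r) ->
  exists r, \det A = \det B + x * r.
Proof.
move=> AB; rewrite /determinant.
apply: (big_ind2 (fun a b => exists r, a = b + x * r)).
- by exists 0; rewrite mulr0 addr0.
- by move=> a b c e [r ->] [s ->]; exists (r + s); ring.
move=> s _.
have [r ->] : exists r, \prod_i A i (s i) = \prod_i B i (s i) + x * r.
  apply: (big_ind2 (fun a b => exists r, a = b + x * r)).
  - by exists 0; rewrite mulr0 addr0.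
  - move=> a b c e [r ->] [t ->]; exists (r * e + b * t + x * r * t); ring.
  - by move=> i _; exact: AB.
by exists ((-1) ^+ s * r); rewrite mulrDr mulrCA.
Qed.

Lemma common_multiple (R : comPzRingType) (T : set R) n (t : 'I_n -> R) :
  multiplicative T -> (forall j, T (t j)) ->
  exists u, T u /\ forall j, exists c, u = c * t j.
Proof.
move=> [T1 TM] Tt; exists (\prod_j t j); split; first exact: big_ind.
by move=> j; exists (\prod_(i | i != j) t i); rewrite (bigD1 j) //= mulrC.
Qed.

Section ExtFinite.
Variables (R : comPzRingType) (N : lmodType R) (I : injective_resolution N).
Implicit Types (A B C M P : lmodType R) (T : set R).

Local Notation d := (ires_d I).

Lemma lin_comb_linear M (V : lmodType R) n (c : 'I_n -> R) (f : 'I_n -> {linear M -> V}) :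
  exists g : {linear M -> V}, forall x, g x = \sum_j c j *: f j x.
Proof.
apply: linear_of => a x y; rewrite scaler_sumr -big_split /=.
apply: eq_bigr => j _; rewrite linearP scalerDr !scalerA.
by rewrite [c j * a]mulrC.
Qed.

(** Finite generation of Ext^(i+1)(M, N), by cocycles [f j] modulo coboundaries. *)
Definition ext_finite i M : Prop :=
  exists n (f : 'I_n -> {linear M -> I i.+1}), (forall j, cocycle (f j)) /\
  forall g : {linear M -> I i.+1}, cocycle g ->
  exists (c : 'I_n -> R) (h : {linear M -> I i}),
    forall x, g x = \sum_j c j *: f j x + d i (h x).

Section Finite.
Hypothesis Rn : noetherian R.

(** Evaluation at [m] generators of [K] embeds Hom(K, V) in the [m]-th power of [V]. *)
Lemma hom_finite (K V : lmodType R) : finite_module K -> finite_module V ->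
  exists n (f : 'I_n -> {linear K -> V}), forall g : {linear K -> V},
  exists c : 'I_n -> R, forall x, g x = \sum_j c j *: f j x.
Proof.
move=> [m [k kE]] Vf; have [l [w wE]] := finite_module_fun m Vf.
pose P : set ('I_m -> V) := [set u | exists f : {linear K -> V}, u = f \o k].
have mP : submodule P.
  split=> [|a _ _ [f ->] [g ->]]; first by exists \0.
  by exists (a \*: f \+ g).
have [|n [u [/choice [f fE] uE]]] := noetherian_span Rn (g := w) mP.
  by move=> x _; exact: wE.
exists n, f => g; have [|c gE] := uE (g \o k); first by exists g.
exists c => x; have [h hE] := lin_comb_linear c f; rewrite -hE.
apply: (linear_span (e := k)) (kE x) => i; rewrite hE.
have := congr1 (fun v => v i) gE; rewrite /= => ->; rewrite fct_sumE.
by apply: eq_bigr => j _; rewrite fE.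
Qed.

(** The connecting map from Hom(A, N) onto Ext^1(C, N) carries generators to generators. *)
Lemma ext_finite0 A B C (i : {linear A -> B}) (q : {linear B -> C}) :
  short_exact i q -> projective_module B -> finite_module A -> finite_module N ->
  ext_finite 0 C.
Proof.
move=> iq pB Af Nf; have [n [f fE]] := hom_finite Af Nf.
have [_ qs _] := iq.
(* [c.1] represents the image of [f j] under the connecting map; [c.2] is the extension to [B] that
   defines it. *)
have /choice [c cE] : forall j, exists c : {linear C -> I 1} * {linear B -> I 0},
    (forall y, c.1 (q y) = d 0 (c.2 y)) /\ forall x, c.2 (i x) = ires_aug I (f j x).
  move=> j; have [F FE] := ires_extend iq (ires_aug I \o f j).
  have [|c cE] := short_exact_descend iq (f := d 0 \o F).
    by move=> x; rewrite /= FE ires_d_aug.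
  by exists (c, F).
exists n, (fun j => (c j).1); split=> [j z|g g0].
  by have [y <-] := qs z; rewrite (cE j).1 ires_dd.
have [|G GE] := pB _ _ (d 0) (g \o q).
  by move=> y; apply/ires_exact; exact: g0.
have [|e eE] := @ires_augK _ _ I A (G \o i).
  by move=> x; rewrite /= GE /= (short_exact_comp0 iq) linear0.
have [a aE] := fE e.
have [H HE] := lin_comb_linear a (fun j => (c j).2).
have [|h hE] := short_exact_descend iq (f := G \- H).
  move=> x; rewrite /= HE -[G (i x)]/((G \o i) x) -eE aE linear_sum.
  apply/eqP; rewrite subr_eq0; apply/eqP.
  by apply: eq_bigr => j _; rewrite linearZ (cE j).2.
exists a, h => z; have [y <-] := qs z; rewrite hE linearB /= GE /=.
rewrite HE linear_sum addrC.
rewrite [X in _ = _ + X](eq_bigr (fun j => d 0 (a j *: (c j).2 y))) ?subrK // => j _.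
by rewrite (cE j).1 linearZ.
Qed.

Lemma ext_finiteS n A B C (i : {linear A -> B}) (q : {linear B -> C}) :
  short_exact i q -> projective_module B -> ext_finite n A -> ext_finite n.+1 C.
Proof.
move=> iq pB [m [f [f0 fE]]].
have [_ qs _] := iq.
have /choice [c cE] : forall j, exists c : {linear C -> I n.+2} * {linear B -> I n.+1},
    (forall y, c.1 (q y) = d n.+1 (c.2 y)) /\ forall x, c.2 (i x) = f j x.
  move=> j; have [F FE] := ires_extend iq (f j).
  have [|c cE] := short_exact_descend iq (f := d n.+1 \o F).
    by move=> x; rewrite /= FE f0.
  by exists (c, F).
exists m, (fun j => (c j).1); split=> [j z|g g0].
  by have [y <-] := qs z; rewrite (cE j).1 ires_dd.
have [|G GE] := pB _ _ (d n.+1) (g \o q).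
  by move=> y; apply/ires_exact; exact: g0.
have [|a [e aE]] := fE (G \o i).
  by move=> x; rewrite /= GE /= (short_exact_comp0 iq) linear0.
have [E EE] := ires_extend iq e.
have [H HE] := lin_comb_linear a (fun j => (c j).2).
have [|h hE] := short_exact_descend iq (f := G \- H \- (d n \o E)).
  move=> x; rewrite /= EE -[G (i x)]/((G \o i) x) aE HE.
  under [X in _ - X - _]eq_bigr do rewrite (cE _).2.
  by rewrite [_ + d n _]addrC addrK subrr.
exists a, h => z; have [y <-] := qs z; rewrite hE !linearB /= GE /= ires_dd subr0.
rewrite HE linear_sum addrC.
rewrite [X in _ = _ + X](eq_bigr (fun j => d n.+1 (a j *: (c j).2 y))) ?subrK // => j _.
by rewrite (cE j).1 linearZ.
Qed.

Lemma finite_ext_finite n M : finite_module M -> finite_module N -> ext_finite n M.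
Proof.
move=> + Nf; elim: n M => [|n IHn] M [m [g gE]];
  have [P [e [K [i [q [eP iq Kf _]]]]]] := finite_presentation Rn gE;
  have pP := basis_projective eP.
  exact: ext_finite0 iq pP Kf Nf.
by apply: (ext_finiteS iq pP); exact: IHn.
Qed.

End Finite.

(** Finitely many generators have a common annihilator [u]. The factor [a] allows [T'] to consist of
    powers of a product having [u] as one factor. *)
Lemma ext_torsion_bounded T i M : multiplicative T ->
  ext_finite i M -> ext_torsion I T i M ->
  exists u, T u /\ forall T' a, T' (a * u) -> ext_torsion I T' i M.
Proof.
move=> mT [n [f [f0 fE]]] tM.
have /choice [t tE] := fun j => tM (f j) (f0 j).
have [u [Tu uE]] := common_multiple mT (fun j => (tE j).1).
have /choice [h hE] : forall j, exists h : {linear M -> I i},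
    forall x, u *: f j x = d i (h x).
  move=> j; have [_ [h hE]] := tE j; have [c ->] := uE j.
  by exists (c \*: h) => x; rewrite -scalerA hE /= linearZ.
exists u; split=> // T' a T'u g g0; exists (a * u); split=> //.
have [c [k kE]] := fE g g0; have [l lE] := lin_comb_linear c h.
have gE x : u *: g x = d i (l x + u *: k x).
  rewrite kE scalerDr scaler_sumr linearD linearZ lE linear_sum; congr (_ + _).
  by apply: eq_bigr => j _; rewrite scalerA mulrC -scalerA hE linearZ.
by exists (a \*: (l \+ u \*: k)) => x; rewrite -scalerA gE -linearZ.
Qed.

(* Nakayama's lemma, by the determinant trick. *)
Lemma ext_torsion_nakayama T i M x : multiplicative T -> ext_finite i M ->
  (forall t r, T t -> T (t + x * r)) ->
  (forall f : {linear M -> I i.+1}, cocycle f ->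
     exists t, T t /\ exists f' : {linear M -> I i.+1},
       cocycle f' /\ forall y, t *: f y = x *: f' y) ->
  ext_torsion I T i M.
Proof.
move=> mT [n [f [f0 fE]]] Tx divx.
have /choice [t tE] := fun j => divx (f j) (f0 j).
have /choice [c cE] : forall j, exists ch : ('I_n -> R) * {linear M -> I i},
    forall y, t j *: f j y = x *: (\sum_k ch.1 k *: f k y + d i (ch.2 y)).
  move=> j; have [_ [f' [f'0 f'E]]] := tE j; have [c [h chE]] := fE f' f'0.
  by exists (c, h) => y /=; rewrite f'E chE.
(* [A] is the diagonal matrix of the [t j] minus [x] times the coefficient matrix; it sends the
   column of the [f k] to coboundaries. *)
pose A : 'M[R]_n := \matrix_(j, k) ((j == k)%:R * t j - x * (c j).1 k).
have AE j y : \sum_k A j k *: f k y = x *: d i ((c j).2 y).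
  under eq_bigr do rewrite mxE scalerBl.
  rewrite sumrB (bigD1 j) //= eqxx mul1r big1 ?addr0 => [|k]; last first.
    by rewrite eq_sym => /negPf ->; rewrite mul0r scale0r.
  rewrite cE scalerDr [X in X - _]addrC -addrA scaler_sumr -sumrB big1 ?addr0 // => k _.
  by rewrite scalerA subrr.
have [r rE] : exists r, \det A = \prod_j t j + x * r.
  have [|r ->] := @det_congr R x n A (diag_mx (\row_j t j)).
    move=> j k; exists (- (c j).1 k); rewrite !mxE mulrN; congr (_ - _).
    by rewrite mulr_natl; case: eqP.
  exists r; rewrite det_diag; congr (_ + _).
  by apply: eq_bigr => j _; rewrite mxE.
have Tdet : T (\det A).
  rewrite rE; apply: Tx; case: mT => T1 TM; apply: big_ind => // j _.
  by case: (tE j).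
(* Multiplication by the adjugate shows that the determinant, which is in [T], kills every
   generator. *)
have /choice [h hE] : forall l, exists h : {linear M -> I i},
    forall y, \det A *: f l y = d i (h y).
  move=> l; have [h hE] := lin_comb_linear (fun j => (\adj A) l j * x) (fun j => (c j).2).
  exists h => y; rewrite hE linear_sum.
  under eq_bigr do rewrite linearZ /= -scalerA -AE scaler_sumr.
  rewrite exchange_big /= (bigD1 l) //= [X in _ = _ + X]big1 => [|k kl].
    under eq_bigr do rewrite scalerA.
    rewrite addr0 -scaler_suml; congr (_ *: _).
    by have /matrixP/(_ l l) := mul_adj_mx A; rewrite !mxE eqxx.
  under eq_bigr do rewrite scalerA.
  rewrite -scaler_suml; have /matrixP/(_ l k) := mul_adj_mx A.
  by rewrite !mxE eq_sym (negPf kl) => ->; rewrite scale0r.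
move=> g g0; have [b [k kE]] := fE g g0; exists (\det A); split=> //.
have [l lE] := lin_comb_linear b h.
exists (l \+ \det A \*: k) => y; rewrite kE scalerDr scaler_sumr /= linearD linearZ /= lE.
rewrite linear_sum; congr (_ + _); apply: eq_bigr => j _.
by rewrite scalerA mulrC -scalerA hE linearZ.
Qed.

Section Multiplication.
Variables (A C : lmodType R) (x : R) (i : {linear A -> A}) (q : {linear A -> C}).
Hypothesis iq : short_exact i q.
Hypothesis iE : forall a, i a = x *: a.

(** Extending [f] along [i] gives [F] with [x *: F] equal to [f]. [F] need not be a cocycle; torsion
    of Ext(C) one degree higher allows a correction through [q], which [x] kills. *)
Lemma ext_torsion_mul_surj T n : ext_torsion I T n.+1 C ->
  forall f : {linear A -> I n.+1}, cocycle f ->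
  exists t, T t /\ exists f' : {linear A -> I n.+1},
    cocycle f' /\ forall y, t *: f y = x *: f' y.
Proof.
move=> hC f f0; have [F FE] := ires_extend iq f.
have xF a : x *: F a = f a by rewrite -linearZ -iE FE.
have [|c cE] := short_exact_descend iq (f := d n.+1 \o F).
  by move=> a /=; rewrite FE f0.
have [_ qs _] := iq.
have [|t [Tt [e eE]]] := hC c.
  by move=> z; have [y <-] := qs z; rewrite cE ires_dd.
exists t; split=> //; exists (t \*: F \- (e \o q)); split=> y /=.
  by rewrite linearB linearZ /= -eE cE subrr.
have xe : x *: e (q y) = 0.
  by rewrite -!linearZ -iE (short_exact_comp0 iq) linear0.
by rewrite scalerBr xe subr0 scalerA mulrC -scalerA xF.
Qed.

Lemma ext_torsion_mul_inj n : ext_torsion I [set 1] n C ->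
  forall (f : {linear A -> I n.+1}) (g : {linear A -> I n}), cocycle f ->
  (forall y, x *: f y = d n (g y)) ->
  exists h : {linear A -> I n}, forall y, f y = d n (h y).
Proof.
move=> hC f g f0 fg; have [G GE] := ires_extend iq g.
have [|c cE] := short_exact_descend iq (f := f \- (d n \o G)).
  by move=> a /=; rewrite GE -fg -linearZ -iE subrr.
have [_ qs _] := iq.
have [|t [-> [e eE]]] := hC c.
  by move=> z; have [y <-] := qs z; rewrite cE linearB /= f0 ires_dd subrr.
exists (G \+ (e \o q)) => y /=.
by rewrite linearD -eE cE scale1r addrC subrK.
Qed.

(** Multiplication by [x] is injective on this Ext, so the factors of [x ^+ k] are cancelled one by
    one. *)
Lemma ext_torsion_mul_powers n T : (forall t, T t -> exists k, t = x ^+ k) ->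
  ext_torsion I T n A -> ext_torsion I [set 1] n C -> ext_torsion I [set 1] n A.
Proof.
move=> Tx hA hC f f0; exists 1; split=> //.
have [t [/Tx [k ->] [g gE]]] := hA f f0.
elim: k g gE => [|k IHk] g gE; first by exists g.
have [||h hE] := @ext_torsion_mul_inj n hC (x ^+ k \*: f) g.
- by move=> y /=; rewrite linearZ /= f0 scaler0.
- by move=> y; rewrite /= scalerA -exprS gE.
by apply: (IHk h) => y; rewrite -hE.
Qed.

End Multiplication.

End ExtFinite.

(** * Devissage *)

Section Devissage.
Variable R : comPzRingType.
Implicit Types (A B C M : lmodType R) (J : set R^o).

Definition prime_ideal J : Prop :=
  ~ J (1 : R) /\ forall a b : R, J (a * b) -> J a \/ J b.

(** An isomorphism of [M] with R/J, given as a surjection from [R] with kernel [J]. *)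
Definition cyclic M J : Prop := exists q : {linear R^o -> M},
  (forall m, exists a, q a = m) /\ forall a, q a = 0 <-> J a.

Lemma cyclic_submodule M J : cyclic M J -> submodule J.
Proof.
move=> [q [_ qJ]]; split=> [|a b c]; first by apply/qJ; rewrite linear0.
by rewrite -!qJ linearP => -> ->; rewrite scaler0 addr0.
Qed.

Lemma cyclic_ann M J a (m : M) : cyclic M J -> J a -> a *: m = 0.
Proof.
move=> [q [qs qJ]] Ja; have [b <-] := qs m.
have -> : a *: q b = b *: q a by rewrite -!linearZ; congr (q _); exact: mulrC.
by rewrite (qJ a).2 // scaler0.
Qed.

Lemma scale_linear M (m : M) : exists f : {linear R^o -> M}, forall a, f a = a *: m.
Proof. by apply: linear_of => a x y; rewrite scalerDl scalerA. Qed.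

Lemma cyclic_generated M (m : M) : exists (A : lmodType R) (i : {linear A -> M}),
  [/\ injective i, cyclic A [set a | a *: m = 0] &
      forall x, (exists y, i y = x) <-> exists a, x = a *: m].
Proof.
have [f fE] := scale_linear m.
have [A [i [ii iE]]] := submodule_embedding (range_submodule f).
have iP x : (exists y, i y = x) <-> exists a, x = a *: m.
  by rewrite -iE /=; split=> [[a <-]|[a ->]]; exists a; rewrite fE.
exists A, i; split=> //.
have [|g gE] := linear_lift (i := i) (f := f) ii.
  by move=> a; apply/iE; exists a.
exists g; split=> [y|a].
  have [a ya] := (iP (i y)).1 (ex_intro _ y erefl).
  by exists a; apply: ii; rewrite gE fE.
split=> [ga|am]; first by rewrite /= -fE -gE ga linear0.
by apply: ii; rewrite gE fE linear0.
Qed.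

Lemma cyclic_quotient A M C (i : {linear A -> M}) (p : {linear M -> C})
  (q : {linear R^o -> M}) : short_exact i p -> (forall m, exists a, q a = m) ->
  cyclic C [set a | exists y, i y = q a].
Proof.
move=> [_ ps ex] qs; exists (p \o q); split=> [z|a]; last exact: ex.
by have [m <-] := ps z; have [a <-] := qs m; exists a.
Qed.

Section Induction.
Hypothesis Rn : noetherian R.
Variable Psi : lmodType R -> Prop.
Hypothesis Psi0 : forall M, zero_module M -> Psi M.
Hypothesis PsiD : forall A B C (i : {linear A -> B}) (q : {linear B -> C}),
  short_exact i q -> Psi A -> Psi C -> Psi B.
Hypothesis Psi_prime : forall M J, cyclic M J -> prime_ideal J ->
  (forall M' J', cyclic M' J' -> J `<` J' -> Psi M') -> Psi M.

(** Noetherian induction on [J]. If [J] is proper and not prime, take [a], [b] outside [J] with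
    product in [J]: the submodule generated by [a] has annihilator (J : a), which contains [b], and
    the quotient is R/(J + a). *)
Lemma cyclic_devissage M J : cyclic M J -> Psi M.
Proof.
move=> MJ; have mJ := cyclic_submodule MJ.
elim/(noetherian_ideal_ind Rn) : J / mJ M MJ => J mJ IHJ M MJ.
have IH M' J' : cyclic M' J' -> J `<` J' -> Psi M'.
  by move=> MJ' JJ'; apply: (IHJ J') => //; exact: cyclic_submodule MJ'.
have [J1|nJ1] := pselect (J (1 : R)).
  by apply: Psi0 => m; rewrite -[m]scale1r; exact: cyclic_ann MJ J1.
have [pJ|] := pselect (prime_ideal J); first exact: Psi_prime MJ pJ IH.
move=> /not_andP [//|/existsNP [a /existsNP [b /not_implyP [Jab /not_orP [nJa nJb]]]]].
have [q [qs qJ]] := MJ.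
have [A [i [ii cA iP]]] := cyclic_generated (q a).
have [C [p ip]] := cokernel_short_exact ii.
have ex c : c *: q a = 0 <-> J (c * a) by rewrite -linearZ; exact: qJ.
apply: (PsiD ip).
  apply: (IH _ _ cA); split=> [c Jc|/(_ b)].
    by apply/ex; rewrite mulrC; exact: (submoduleZ mJ).
  by move=> h; apply/nJb/h/ex; rewrite mulrC.
apply: (IH _ _ (cyclic_quotient ip qs)); split=> [c Jc|/(_ a)].
  by exists 0; rewrite linear0; apply/esym/qJ.
by move=> h; apply/nJa/h/iP; exists 1; rewrite scale1r.
Qed.

End Induction.

(** Induction on the number of generators, splitting off the submodule generated by the first; [F]
    is a side condition inherited by the pieces. *)
Lemma finite_devissage (Psi : lmodType R -> Prop) (F : lmodType R -> Prop) :
  (forall A B C (i : {linear A -> B}) (q : {linear B -> C}),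
    short_exact i q -> F B -> F A /\ F C) ->
  (forall M, F M -> zero_module M -> Psi M) ->
  (forall A B C (i : {linear A -> B}) (q : {linear B -> C}),
    short_exact i q -> Psi A -> Psi C -> Psi B) ->
  (forall M J, F M -> cyclic M J -> Psi M) ->
  forall M, finite_module M -> F M -> Psi M.
Proof.
move=> Fex Psi0 PsiD Psic M [n [g gM]].
elim: n M g gM => [|n IHn] M g gM FM.
  by apply: Psi0 => // x; have [c ->] := gM x; rewrite big_ord0.
have [A [i [ii cA iP]]] := cyclic_generated (g ord0).
have [C [p ip]] := cokernel_short_exact ii.
have [FA FC] := Fex _ _ _ _ _ ip FM.
apply: (PsiD _ _ _ _ _ ip); first exact: Psic cA.
apply: (IHn C (fun j => p (g (lift ord0 j)))) => // z.
have [_ ps ex] := ip; have [y <-] := ps z; have [c ->] := gM y.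
exists (fun j => c (lift ord0 j)); rewrite big_ord_recl linearD.
have [_ h] := ex (c ord0 *: g ord0).
rewrite h ?add0r; last by apply/iP; exists (c ord0).
by rewrite linear_sum; apply: eq_bigr => j _; rewrite linearZ.
Qed.

End Devissage.

(** * Restriction of scalars from a localization *)

Section Restriction.
Variables (R : comPzRingType) (p : spec R).

Local Notation A := (locring p).
Local Notation "1d" := (denom1 p).

Lemma locring_mulE (a b : R) (s t : denom p) :
  (locfrac (a : R^o) s : A) * (locfrac (b : R^o) t : A) =
  locfrac (a * b : R^o) (denomM s t).
Proof. exact: locscaleE. Qed.

Lemma locfrac_eq1 (s : denom p) : locfrac (denom_val s : R^o) s = (1 : A).
Proof. by apply/locfracP; exists 1d; rewrite /= !scale1r; exact: (esym (mulr1 _)). Qed.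

(** A type synonym that carries the [R]-module structure of [M]. *)
Definition restr (M : lmodType A) : Type := M.
HB.instance Definition _ (M : lmodType A) := GRing.Zmodule.on (restr M).

Section Restr.
Variable M : lmodType A.

Definition restr_scale (a : R) (x : restr M) : restr M :=
  (locfrac (a : R^o) 1d : A) *: (x : M).

Lemma restr_scaleA a b x : restr_scale a (restr_scale b x) = restr_scale (a * b) x.
Proof.
rewrite /restr_scale scalerA locring_mulE; congr (_ *: _).
by apply/locfracP; exists 1d; rewrite /= ?mul1r ?scale1r ?mul1r.
Qed.

Lemma restr_scale1 : left_id 1 restr_scale.
Proof. by move=> x; exact: scale1r. Qed.

Lemma restr_scaleDr : right_distributive restr_scale +%R.
Proof. by move=> a x y; exact: scalerDr. Qed.

Lemma restr_scaleDl x : {morph restr_scale^~ x : a b / a + b}.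
Proof. by move=> a b; rewrite /restr_scale locfracDr; exact: scalerDl. Qed.

HB.instance Definition _ := GRing.Zmodule_isLmodule.Build R (restr M)
  restr_scaleA restr_scale1 restr_scaleDr restr_scaleDl.

Lemma restr_scaleE (a : R) (x : restr M) :
  a *: x = (locfrac (a : R^o) 1d : A) *: (x : M).
Proof. by []. Qed.

Lemma restr_div_linear (s : denom p) : exists f : {linear restr M -> restr M},
  forall x, denom_val s *: f x = x.
Proof.
have [|f fE] := @linear_of R (restr M) (restr M) (fun x => (locfrac (1 : R^o) s : A) *: (x : M)).
  move=> a x y; apply: (etrans (@scalerDr A M _ _ _)); congr (_ + _).
  have C (b c : A) (z : M) : b *: (c *: z) = c *: (b *: z) by rewrite !scalerA mulrC.
  exact: C.
exists f => x; rewrite fE; apply: (etrans (@scalerA A M _ _ _)).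
rewrite locring_mulE mulr1 -[RHS](scale1r (x : M)) -(locfrac_eq1 s).
congr (_ *: _); apply/locfracP; exists 1d.
by rewrite /= !mul1r.
Qed.

Lemma restr_inj (s : denom p) (x y : restr M) :
  denom_val s *: x = denom_val s *: y -> x = y.
Proof.
have [f fE] := restr_div_linear s; move=> /(congr1 f).
by rewrite !linearZ /= !fE.
Qed.

End Restr.

Lemma restr_linearP (U V : lmodType A) (f : {linear U -> V}) :
  linear (f : restr U -> restr V).
Proof. by move=> a x y; exact: linearP. Qed.

Definition restr_map (U V : lmodType A) (f : {linear U -> V}) :
  {linear restr U -> restr V} :=
  HB.pack_for {linear restr U -> restr V} (f : restr U -> restr V)
    (GRing.isLinear.Build R (restr U) (restr V) *:%R _ (restr_linearP f)).

(** Denominators act injectively on the target, so compatibility with fractions can be checked after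
    clearing them. *)
Lemma restr_full (U V : lmodType A) (f : {linear restr U -> restr V}) :
  exists g : {linear U -> V}, g =1 f.
Proof.
apply: linear_of => b x y; have [a [s ->]] := locfracE b.
have -> : f ((locfrac a s : A) *: x + y) = f ((locfrac a s : A) *: x) + f y.
  exact: (linearD f).
congr (_ + _); apply: (@restr_inj _ s).
have fracE (M : lmodType A) (z : M) :
    denom_val s *: ((locfrac a s : A) *: z : restr M) = (a : R) *: (z : restr M).
  rewrite restr_scaleE; apply: (etrans (@scalerA A M _ _ _)).
  rewrite locring_mulE; apply: (congr1 (fun b : A => b *: (z : M))).
  by apply/locfracP; exists 1d; rewrite /= !scale1r mul1r.
have fZ c z : f (c *: z) = c *: f z by exact: linearZ_LR.
by rewrite -fZ (fracE U) (fracE V) fZ.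
Qed.

Lemma restr_injective_descend (M : lmodType A) :
  injective_module (restr M) -> injective_module M.
Proof.
move=> iM U V i f ii.
have [g gE] := iM _ _ (restr_map i) (restr_map f) ii.
by have [h hE] := restr_full g; exists h => x; rewrite hE; exact: gE.
Qed.

Section LocalizationMap.
Variable U : lmodType R.

Lemma locfrac1_linear : exists f : {linear U -> restr (locmod p U)},
  forall x, f x = locfrac x 1d.
Proof.
apply: linear_of => a x y; rewrite locfracDr; congr (_ + _).
rewrite restr_scaleE; apply: etrans (esym (locscaleE _ _ _ _)).
by apply/locfracP; exists 1d; rewrite /= ?mul1r ?scale1r ?mul1r.
Qed.

Lemma locfrac1_eq0 (x : U) :
  locfrac x 1d = 0 -> exists t, t \notin p /\ t *: x = 0.
Proof.
move=> /locfracP [c /= cE]; exists (denom_val c); split; first exact: denom_valP.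
by move: cE; rewrite !scale1r scaler0.
Qed.

Lemma restr_scale_locfrac (a : R) (x : U) s :
  a *: (locfrac x s : restr (locmod p U)) = locfrac (a *: x) s.
Proof.
rewrite restr_scaleE; apply: etrans (locscaleE _ _ _ _) _.
by apply/locfracP; exists 1d; rewrite /= ?mul1r ?scale1r ?mul1r.
Qed.

Lemma locfrac_cancel (x : U) s :
  denom_val s *: (locfrac x s : restr (locmod p U)) = locfrac x 1d.
Proof.
rewrite restr_scale_locfrac.
by apply/locfracP; exists 1d; rewrite /= ?mul1r ?scale1r ?mul1r.
Qed.

Lemma locmod_universal (M : lmodType A) (f : {linear U -> restr M}) :
  exists F : {linear locmod p U -> M}, forall x, F (locfrac x 1d) = f x.
Proof.
(* Denominators act invertibly on [M], so one [y] serves all fractions that represent [u]. *)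
have /choice [F FE] : forall u : locmod p U, exists y : restr M,
    forall x s, u = locfrac x s -> denom_val s *: y = f x.
  move=> u; have [x [s uE]] := locfracE u; have [g gE] := @restr_div_linear M s.
  exists (g (f x)) => y t; rewrite uE => /locfracP [c cE].
  apply: (@restr_inj _ (denomM c s)) => /=.
  have fZ b z : f (b *: z) = b *: f z by exact: linearZ_LR.
  have /= := congr1 f cE; rewrite !fZ !scalerA => <-.
  by rewrite -[X in _ = _ *: X]gE !scalerA; congr (_ *: _); ring.
have Fl : linear (F : restr (locmod p U) -> restr M).
  move=> a u v; have [x [y [s [uE vE]]]] := frac_common u v.
  apply: (@restr_inj _ s).
  rewrite (FE _ (a *: x + y) s); last first.
    by rewrite locfracDr uE vE -restr_scale_locfrac.
  rewrite linearP -(FE _ _ _ uE) -(FE _ _ _ vE) scalerDr !scalerA.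
  by rewrite [a * _]mulrC.
have [G GE] := linear_of Fl; have [H HE] := restr_full G.
exists H => x; rewrite HE GE.
by have := FE _ x 1d erefl; rewrite /= scale1r.
Qed.

End LocalizationMap.

(** Restriction is right adjoint to localization, and localization preserves injectivity of [i]. *)
Lemma restr_injective (M : lmodType A) :
  injective_module M -> injective_module (restr M).
Proof.
move=> iM U V i f ii.
have [l lE] := locfrac1_linear V.
have [L LE] := locmod_universal (l \o i : {linear U -> restr (locmod p V)}).
have [F FE] := locmod_universal f.
have [|G GE] := iM _ _ L F.
  apply: linear_inj => u; have [x [s ->]] := locfracE u.
  move=> Lu.
  have Lx : L (locfrac x 1d) = 0.
    rewrite -(locfrac_cancel x s); apply: etrans (linearZ_LR (restr_map L) _ _) _.
    by rewrite [restr_map L _]Lu scaler0.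
  move: Lx; rewrite LE /= lE => /locfrac1_eq0 [t [tp tx]].
  apply/locfracP; exists (Denom tp) => /=; rewrite !scaler0 scale1r.
  by apply: ii; rewrite linearZ /= tx linear0.
have [g gE] := linear_of (restr_linearP G).
have [e eE] := locfrac1_linear V.
by exists (g \o e) => x; rewrite /= gE eE -FE -GE LE /= lE.
Qed.

Definition restr_resolution (M : lmodType A) (I : injective_resolution M) :
  injective_resolution (restr M) :=
  @InjectiveResolution R (restr M) (fun i => restr (I i))
    (fun i => restr_map (ires_d I i)) (restr_map (ires_aug I))
    (fun i => restr_injective (@ires_injective _ _ I i)) (@ires_aug_inj _ _ I)
    (@ires_exact0 _ _ I) (@ires_exact _ _ I).

End Restriction.

(** * Ext into a localization *)

Section LocalizedExt.
Variables (R : comPzRingType) (p : spec R).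
Hypothesis Rn : noetherian R.

Local Notation "1d" := (denom1 p).
Implicit Types (K M P : lmodType R).

Definition prime_compl : set R := [set t | t \notin p].

Lemma prime_compl_multiplicative : multiplicative prime_compl.
Proof. by split=> [|s t]; [exact: spec_compl1|exact: spec_complM]. Qed.

Lemma prime_complD t x r : prime_compl t -> x \in p -> prime_compl (t + x * r).
Proof.
rewrite /prime_compl /= => tp xp; apply/negP => txp; move/negP: tp; apply.
have [p0 pl] := spec_submod p.
have -> : t = (- r) *: (x : R^o) + (t + x * r) by rewrite /GRing.scale /=; ring.
exact: pl.
Qed.

Section HomLocalization.
Variables (K N : lmodType R) (l : {linear N -> restr (locmod p N)}).
Hypothesis lE : forall x, l x = locfrac x 1d.
Hypothesis Kf : finite_module K.

Lemma hom_locfrac_eq0 (f : {linear K -> N}) : (forall x, l (f x) = 0) ->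
  exists t, prime_compl t /\ forall x, t *: f x = 0.
Proof.
move=> f0; have [n [g gE]] := Kf.
have /choice [t tE] : forall j, exists t, prime_compl t /\ t *: f (g j) = 0.
  by move=> j; apply: locfrac1_eq0; rewrite -lE f0.
have [u [Tu uE]] := common_multiple prime_compl_multiplicative (fun j => (tE j).1).
exists u; split=> // x.
have := linear_span (f := u \*: f) (g := \0) (e := g) (x := x); apply=> // j /=.
by have [c ->] := uE j; rewrite -scalerA (tE j).2 scaler0.
Qed.

(** Clearing denominators on the generators gives a map [F] from a free module. It sends the
    relations [L] to elements that vanish in the localization; as [L] is finite, a single [v] kills
    them. *)
Lemma hom_locfrac_lift (f : {linear K -> restr (locmod p N)}) :
  exists t, prime_compl t /\ exists f' : {linear K -> N}, forall x, l (f' x) = t *: f x.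
Proof.
have [n [g gE]] := Kf.
have [P [e [L [i [q [[eP eu] iq Lf qe]]]]]] := finite_presentation Rn gE.
have /choice [s sE] : forall j, exists s : N * R, prime_compl s.2 /\
    l s.1 = s.2 *: f (g j).
  move=> j; have [x [s ->]] := locfracE (f (g j)).
  by exists (x, denom_val s); split; [exact: denom_valP|rewrite locfrac_cancel lE].
have [u [Tu uE]] := common_multiple prime_compl_multiplicative (fun j => (sE j).1).
have /choice [y yE] : forall j, exists y, l y = u *: f (g j).
  move=> j; have [c ->] := uE j; exists (c *: (s j).1).
  by rewrite linearZ /= (sE j).2 scalerA.
have [F FE] := eu N y.
have lF x : l (F x) = u *: f (q x).
  have := linear_span (f := l \o F) (g := u \*: (f \o q)) (e := e) (x := x).
  by apply=> // j /=; rewrite FE yE qe.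
pose G : {linear L -> N} := F \o i.
have cE z : l (G z) = 0.
  by rewrite lF (short_exact_comp0 iq) linear0 scaler0.
have [m [h hE]] := Lf.
have /choice [t tE] : forall j, exists t, prime_compl t /\ t *: G (h j) = 0.
  by move=> j; apply: locfrac1_eq0; rewrite -lE cE.
have [v [Tv vE]] := common_multiple prime_compl_multiplicative (fun j => (tE j).1).
have vG x : v *: G x = 0.
  have := linear_span (f := v \*: G) (g := \0) (e := h) (x := x); apply=> // j /=.
  by have [b ->] := vE j; rewrite -scalerA (tE j).2 scaler0.
have [|f' f'E] := short_exact_descend iq (f := v \*: F).
  by move=> x; exact: vG.
exists (v * u); split; first by case: prime_compl_multiplicative => _; apply.
exists f' => x; have [_ qs _] := iq; have [z <-] := qs x.
by rewrite f'E /= linearZ /= lF scalerA.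
Qed.

End HomLocalization.

(** Dimension shifting leads to the cokernel of a map between Hom modules, and Hom from a finite
    module commutes with localization. Both sides are Ext over [R]; only the second argument is
    localized. *)
Lemma ext_torsion_localization N (I : injective_resolution N)
  (J : injective_resolution (restr (locmod p N))) i M : finite_module M ->
  ext_torsion I prime_compl i M <-> ext_torsion J [set 1] i M.
Proof.
have m1 := multiplicative1 R; have mT := prime_compl_multiplicative.
have [T1 TM] := mT.
elim: i M => [|i IHi] M [n [g gE]];
  have [P [e [K [a [q [eP aq Kf _]]]]]] := finite_presentation Rn gE;
  have pP := basis_projective eP; last first.
  by rewrite !(ext_torsion_shift _ aq) //; exact: IHi.
have Pf : finite_module P by exists n, e; case: eP.
have [l lE] := locfrac1_linear p N.
rewrite !(ext_torsion0P _ aq) //; split=> h f.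
  have [u [Tu [f' f'E]]] := hom_locfrac_lift lE Kf f.
  have [t [Tt [g' g'E]]] := h f'.
  have [d dE] := restr_div_linear (locmod p N) (Denom (TM _ _ Tt Tu)).
  exists 1; split=> //; exists (d \o (l \o g')) => x.
  rewrite scale1r /= -g'E linearZ /= f'E scalerA linearZ /=.
  exact: (esym (dE (f x))).
have [t [-> [g' g'E]]] := h (l \o f).
have [u [Tu [g'' g''E]]] := hom_locfrac_lift lE Pf g'.
(* The two maps agree only after localization; a further denominator [v] makes them agree in [N]. *)
have [|v [Tv vE]] := hom_locfrac_eq0 lE Kf (f := u \*: f \- (g'' \o a)).
  move=> x /=; rewrite linearB g''E -g'E scale1r linearZ.
  exact: subrr.
exists (v * u); split; first exact: TM.
exists (v \*: g'') => x /=; apply/eqP; rewrite -subr_eq0 -scalerA -scalerBr; apply/eqP.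
exact: vE.
Qed.

End LocalizedExt.

(* [C] is the [k]-th cosyzygy: the cohomology of [Hom (R/J, I)] in degree [k + 1] is
   [Ext^1(R/J, C)]. *)
Lemma cosyzygy_baer (R : comPzRingType) (N : lmodType R) (I : injective_resolution N)
    k (C : lmodType R) (c : {linear C -> I k}) :
  injective c -> (forall x, ires_d I k x = 0 <-> exists y, c y = x) ->
  (forall M J, cyclic M J -> ext_torsion I [set 1] k M) -> baer C.
Proof.
move=> ci cE hM J mJ f fl.
have [S [i [ii iE]]] := submodule_embedding mJ.
have [Q [q iq]] := cokernel_short_exact ii.
have [h0 h0E] : exists h : {linear S -> I k}, forall s, h s = c (f (i s)).
  apply: linear_of => a x y.
  have -> : f (i (a *: x + y)) = a *: f (i x) + f (i y).
    by rewrite linearP; apply: fl; apply/iE; eexists.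
  by rewrite linearP.
have [F FE] := ires_extend iq h0.
have [|g gE] := short_exact_descend iq (f := ires_d I k \o F).
  by move=> x; rewrite /= FE h0E; apply/cE; eexists.
have [_ qs ex] := iq.
have cQ : cyclic Q [set a | q a = 0] by exists q.
have [|t [-> [h hE]]] := hM Q _ cQ g.
  by move=> z; have [y <-] := qs z; rewrite gE ires_dd.
have [|z zE] := (cE (F 1 - h (q 1))).1.
  by rewrite linearB -hE gE /= scale1r subrr.
exists z => a Ja; apply: ci; rewrite linearZ /= zE.
have [s sa] := (iE a).1 Ja.
rewrite scalerBr -!linearZ.
have -> : a *: (1 : R^o) = a by exact: mulr1.
by rewrite -sa FE h0E (short_exact_comp0 iq) linear0 subr0.
Qed.

(** * Koszul complexes *)

Section Koszul.
Variable R : comPzRingType.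

Lemma projective_prod (P Q : lmodType R) : projective_module P ->
  projective_module Q -> projective_module (P * Q)%type.
Proof.
move=> pP pQ U V q f fq.
have [i iE] := @linear_of R P (P * Q)%type (fun u => (u, 0))
  (fun a x y => congr2 pair erefl (esym (etrans (congr1 (+%R^~ 0) (scaler0 Q a)) (addr0 0)))).
have [j jE] := @linear_of R Q (P * Q)%type (fun u => (0, u))
  (fun a x y => congr2 pair (esym (etrans (congr1 (+%R^~ 0) (scaler0 P a)) (addr0 0))) erefl).
have [|g gE] := pP _ _ q (f \o i); first by move=> x; exact: fq.
have [|h hE] := pQ _ _ q (f \o j); first by move=> x; exact: fq.
have [k kE] : exists k : {linear (P * Q)%type -> U}, forall w, k w = g w.1 + h w.2.
  by apply: linear_of => a x y; rewrite !linearP scalerDr addrACA.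
exists k => -[u v]; rewrite kE linearD gE hE /= -linearD iE jE; congr (f _).
by congr pair; rewrite ?addr0 ?add0r.
Qed.

(* The complex [C] with [C 0 = R] (through [phi]); the homotopies show that every
   [x] in [xs] kills the homology. *)
Record koszul_complex (xs : seq R) := KoszulComplex {
  kos :> nat -> lmodType R;
  kos_d : forall n, {linear kos n.+1 -> kos n};
  kos_phi : {linear R^o -> kos 0};
  kos_phi_inj : injective kos_phi;
  kos_phi_surj : forall c, exists a, kos_phi a = c;
  kos_dd : forall n c, kos_d n (kos_d n.+1 c) = 0;
  kos_im : forall J : set R^o, submodule J -> (forall x, x \in xs -> J x) ->
    forall c, exists a, J a /\ kos_d 0 c = kos_phi a;
  kos_projective : forall n, projective_module (kos n);
  kos_finite : forall n, finite_module (kos n);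
  kos_bounded : forall n, (size xs < n)%N -> zero_module (kos n);
  kos_homotopy : forall x, x \in xs -> exists h : forall n, {linear kos n -> kos n.+1},
    (forall c, kos_d 0 (h 0 c) = x *: c) /\
    forall n c, kos_d n.+1 (h n.+1 c) + h n (kos_d n c) = x *: c
}.

Lemma koszul_nil : exists K : koszul_complex [::], True.
Proof.
pose C n : lmodType R := if n is 0 then R^o else ('I_0 -> R^o).
have [phi phiE] := @linear_of R R^o R^o id (fun a x y => erefl).
have C0 n : zero_module (C n.+1) by move=> f; apply/funext; case.
unshelve eexists (@KoszulComplex [::] C (fun n => \0 : {linear C n.+1 -> C n}) phi
  _ _ _ _ _ _ _ _) => //.
- by move=> x y; rewrite !phiE.
- by move=> c; exists c; rewrite phiE.
- by move=> J mJ _ c; exists 0; rewrite linear0; split=> //; exact: (submodule0 mJ).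
- move=> [|n] U V q f fq.
    have [u uE] := fq 1; have [g gE] := scale_linear u; exists g => x.
    by rewrite gE linearZ /= uE -linearZ; congr (f _); exact: mulr1.
  by exists \0 => x; rewrite linear0 (C0 n x) linear0.
- move=> [|n]; last first.
    exists 0%N, (fun=> 0) => x; exists (fun=> 0).
    by rewrite (C0 n x) (C0 n (\sum_i _)).
  exists 1%N, (fun=> 1) => x; exists (fun=> x); rewrite big_ord1; exact: (esym (mulr1 _)).
- by case.
Qed.

Section Cone.
Variables (x : R) (xs : seq R) (K : koszul_complex xs).
Local Notation d := (kos_d K).

(** The mapping cone of multiplication by [x] on [K]. *)
Definition cone n : lmodType R :=
  if n is m.+1 then (K m.+1 * K m)%type : lmodType R else K 0.

Lemma cone_d0_linear : linear (fun w : (K 1 * K 0)%type => d 0 w.1 + x *: w.2).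
Proof. by move=> a u v /=; rewrite linearP !scalerDr addrACA !scalerA [x * a]mulrC. Qed.

Lemma cone_dS_linear n :
  linear (fun w : (K n.+2 * K n.+1)%type => (d n.+1 w.1 + x *: w.2, - d n w.2)).
Proof.
move=> a u v; rewrite pair_linE; apply: (congr2 pair); last by rewrite /= !linearP.
by rewrite /= linearP !scalerDr addrACA !scalerA [x * a]mulrC.
Qed.

Lemma cone_h0_linear (h : {linear K 0 -> K 1}) :
  linear (fun c : K 0 => (h c, 0) : (K 1 * K 0)%type).
Proof. by move=> a u v; rewrite pair_linE linearP scaler0 addr0. Qed.

Lemma cone_hS_linear n (h : {linear K n.+1 -> K n.+2}) (h' : {linear K n -> K n.+1}) :
  linear (fun w : (K n.+1 * K n)%type => (h w.1, - h' w.2)).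
Proof. by move=> a u v; rewrite pair_linE /= !linearP. Qed.

Lemma cone_k0_linear : linear (fun c : K 0 => (0, c) : (K 1 * K 0)%type).
Proof. by move=> a u v; rewrite pair_linE scaler0 addr0. Qed.

Lemma cone_kS_linear n :
  linear (fun w : (K n.+1 * K n)%type => (0, w.1) : (K n.+2 * K n.+1)%type).
Proof. by move=> a u v; rewrite pair_linE scaler0 addr0. Qed.

Definition cone_d n : {linear cone n.+1 -> cone n} :=
  match n with
  | 0 => projT1 (cid (linear_of cone_d0_linear))
  | m.+1 => projT1 (cid (linear_of (@cone_dS_linear m)))
  end.

Lemma cone_d0E a b : cone_d 0 (a, b) = d 0 a + x *: b.
Proof. exact: (projT2 (cid (linear_of cone_d0_linear))). Qed.

Lemma cone_dSE n a b : cone_d n.+1 (a, b) = (d n.+1 a + x *: b, - d n b).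
Proof. exact: (projT2 (cid (linear_of (@cone_dS_linear n)))). Qed.

(** The old homotopy on both summands, with a sign on the second to match the sign in [cone_d]. *)
Lemma cone_homotopy_old y : y \in xs ->
  exists h : forall n, {linear cone n -> cone n.+1},
    (forall c, cone_d 0 (h 0 c) = y *: c) /\
    forall n c, cone_d n.+1 (h n.+1 c) + h n (cone_d n c) = y *: c.
Proof.
move=> yxs; have [h [h0 hS]] := kos_homotopy K yxs.
pose h' n : {linear cone n -> cone n.+1} :=
  match n with
  | 0 => projT1 (cid (linear_of (cone_h0_linear (h 0))))
  | m.+1 => projT1 (cid (linear_of (cone_hS_linear (h m.+1) (h m))))
  end.
have h'0 c : h' 0 c = (h 0 c, 0).
  exact: (projT2 (cid (linear_of (cone_h0_linear (h 0))))).
have h'S n a b : h' n.+1 (a, b) = (h n.+1 a, - h n b).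
  exact: (projT2 (cid (linear_of (cone_hS_linear (h n.+1) (h n))))).
have dN n c : d n (- c) = - d n c by exact: linearN.
have hN n c : h n (- c) = - h n c by exact: linearN.
exists h'; split=> [c|[|n] [a b]]; first by rewrite h'0 cone_d0E scaler0 addr0 h0.
  rewrite h'S cone_d0E cone_dSE h'0; apply: (congr2 pair) => /=.
    rewrite linearD linearZ scalerN addrACA /= [- _ + _]addrC subrr addr0.
    exact: hS.
  by rewrite addr0 dN opprK h0.
rewrite h'S !cone_dSE h'S; apply: (congr2 pair) => /=.
  rewrite linearD linearZ scalerN addrACA /= [- _ + _]addrC subrr addr0.
  exact: hS.
by rewrite dN hN !opprK hS.
Qed.

(** On its own cone, multiplication by [x] is null-homotopic through the shift of (a, b) to (0,
    a). *)
Lemma cone_homotopy_new :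
  exists h : forall n, {linear cone n -> cone n.+1},
    (forall c, cone_d 0 (h 0 c) = x *: c) /\
    forall n c, cone_d n.+1 (h n.+1 c) + h n (cone_d n c) = x *: c.
Proof.
pose h n : {linear cone n -> cone n.+1} :=
  match n with
  | 0 => projT1 (cid (linear_of cone_k0_linear))
  | m.+1 => projT1 (cid (linear_of (@cone_kS_linear m)))
  end.
have h0 c : h 0 c = (0, c) by exact: (projT2 (cid (linear_of cone_k0_linear))).
have hS n a b : h n.+1 (a, b) = (0, a).
  exact: (projT2 (cid (linear_of (@cone_kS_linear n)))).
exists h; split=> [c|[|n] [a b]]; first by rewrite h0 cone_d0E linear0 add0r.
  rewrite hS cone_d0E cone_dSE h0; apply: (congr2 pair) => /=.
    by rewrite linear0 add0r addr0.
  by rewrite addKr.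
rewrite hS !cone_dSE hS; apply: (congr2 pair) => /=.
  by rewrite linear0 add0r addr0.
by rewrite addKr.
Qed.

Lemma koszul_cone : exists K' : koszul_complex (x :: xs), True.
Proof.
unshelve eexists (@KoszulComplex (x :: xs) cone cone_d (kos_phi K)
  (@kos_phi_inj _ K) (@kos_phi_surj _ K) _ _ _ _ _ _) => //.
- move=> [|n] [a b]; rewrite cone_dSE.
    by rewrite cone_d0E linearD kos_dd add0r linearZ scalerN subrr.
  by rewrite cone_dSE linearD kos_dd add0r linearZ scalerN subrr linearN kos_dd !oppr0.
- move=> J mJ Jx [a b]; rewrite cone_d0E.
  have [|a' [Ja' ->]] := kos_im mJ _ a.
    by move=> y yxs; apply: Jx; rewrite inE yxs orbT.
  have [b' <-] := kos_phi_surj b; exists (a' + x *: b'); split.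
    apply: (submoduleD mJ Ja'); rewrite [_ *: _]mulrC; apply: (submoduleZ mJ).
    by apply: Jx; rewrite inE eqxx.
  by rewrite linearD linearZ.
- move=> [|n]; first exact: kos_projective.
  exact: (projective_prod (@kos_projective _ K n.+1) (@kos_projective _ K n)).
- move=> [|n]; first exact: kos_finite.
  exact: (finite_module_prod (kos_finite K _) (kos_finite K _)).
- move=> [|n] //= nx [a b].
  by rewrite (kos_bounded (ltnW nx) a) (kos_bounded nx b).
- move=> y; rewrite inE => /orP[/eqP ->|]; first exact: cone_homotopy_new.
  exact: cone_homotopy_old.
Qed.

End Cone.

Lemma koszul_exists xs : exists K : koszul_complex xs, True.
Proof.
elim: xs => [|x xs [K _]]; first exact: koszul_nil.
exact: koszul_cone.
Qed.

End Koszul.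

(** * Propagation of torsion along the Koszul complex *)

Section KoszulWindow.
Variables (R : comPzRingType) (Rn : noetherian R).
Implicit Types (A B C M : lmodType R) (J : set R^o).

Definition killed_by J M : Prop := forall (a : R) (m : M), J a -> a *: m = 0.

(** [H] is the homology at [C1]. It is produced before [N], [I] and [T], so that elements to invert
    can be chosen for it before [T] is fixed. *)
Lemma ext_torsion_cycle_step (C2 C1 C0 : lmodType R)
  (d1 : {linear C2 -> C1}) (d0 : {linear C1 -> C0}) J :
  finite_module C1 -> projective_module C1 -> (forall c, d0 (d1 c) = 0) ->
  (forall a c, J a -> d0 c = 0 -> exists y, d1 y = a *: c) ->
  exists H : lmodType R, [/\ finite_module H, killed_by J H &
    forall N (I : injective_resolution N) T k B1 B0
      (b1 : {linear B1 -> C1}) (b0 : {linear B0 -> C0}), multiplicative T ->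
      injective b1 -> (forall x, (exists y, d1 y = x) <-> exists y, b1 y = x) ->
      injective b0 -> (forall x, (exists y, d0 y = x) <-> exists y, b0 y = x) ->
      ext_torsion I T k H -> ext_torsion I T k B1 -> ext_torsion I T k.+1 B0].
Proof.
move=> C1f pC1 dd dJ.
have [Z [z [zi zE]]] := submodule_embedding (kernel_submodule d0).
have [g gE] : exists g : {linear C2 -> Z}, forall x, z (g x) = d1 x.
  by apply: linear_lift => // x; apply/zE; exact: dd.
have [H [q [qs qE]]] := submodule_quotient (range_submodule g).
exists H; split.
- by apply: (finite_module_image qs); exact: finite_module_sub zi C1f.
- move=> a m Ja; have [c <-] := qs m; rewrite -linearZ; apply/qE.
  have [|y yE] := dJ a (z c) Ja; first by apply/zE; exists c.
  by exists y; apply: zi; rewrite gE yE linearZ.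
move=> N I T k B1 B0 b1 b0 mT b1i b1E b0i b0E tH tB1.
have [b bE] : exists b : {linear B1 -> Z}, forall x, z (b x) = b1 x.
  apply: linear_lift => // x; apply/zE.
  by have [y <-] := (b1E (b1 x)).2 (ex_intro _ x erefl); exact: dd.
have bq : short_exact b q.
  split=> // [x y /(congr1 z)|y]; first by rewrite !bE => /b1i.
  rewrite qE /=; split=> -[x xy].
    have [w wE] := (b1E (d1 x)).1 (ex_intro _ x erefl).
    by exists w; apply: zi; rewrite bE wE -xy gE.
  have [w wE] := (b1E (b1 x)).2 (ex_intro _ x erefl).
  by exists w; apply: zi; rewrite gE wE -xy bE.
have tZ : ext_torsion I T k Z by exact: (ext_torsion_mid bq).
have [e eE] : exists e : {linear C1 -> B0}, forall x, b0 (e x) = d0 x.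
  by apply: linear_lift => // x; apply/b0E; exists x.
have ze : short_exact z e.
  split=> // [x|y].
    have [y yE] := (b0E (b0 x)).2 (ex_intro _ x erefl).
    by exists y; apply: b0i; rewrite eE.
  rewrite -zE /= -eE; split=> [->|ey]; first exact: linear0.
  by apply: b0i; rewrite ey linear0.
apply: (ext_torsion_quot ze mT tZ); exact: ext_torsion_projective.
Qed.

(* With [Z_j], [B_j] the cycles and boundaries of the Koszul complex and [H_j] its
   homology, torsion of [Ext^k(B_j)] and [Ext^k(H_j)] passes to [Ext^k(Z_j)], then
   to [Ext^(k+1)(B_(j-1))]; start from [B_r = 0] and end at [B_0 = J], [R/J]. *)
Lemma ext_torsion_window (xs : seq R) J : submodule J ->
  (forall x, x \in xs -> J x) ->
  (forall P : set R^o, submodule P -> (forall x, x \in xs -> P x) -> J `<=` P) ->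
  exists H : nat -> lmodType R, (forall j, finite_module (H j) /\ killed_by J (H j)) /\
    forall N (I : injective_resolution N) T E m, multiplicative T -> cyclic E J ->
    (forall j, (j < size xs)%N -> ext_torsion I T (m + (size xs - j.+1)) (H j)) ->
    ext_torsion I T (m + size xs).+1 E.
Proof.
move=> mJ Jxs xsJ; have [K _] := koszul_exists xs.
(* The [a] for which [a *: c] is a boundary form an ideal, which contains [xs] by the homotopies and
   hence contains [J]. *)
have JK n a c : J a -> kos_d K n c = 0 -> exists y, kos_d K n.+1 y = a *: c.
  move=> Ja c0; pose P : set R^o := [set a | exists y, kos_d K n.+1 y = a *: c].
  apply: (xsJ P) => // [|x xxs].
    split=> [|u v w [y yE] [y' y'E]]; first by exists 0; rewrite linear0 scale0r.
    by exists (u *: y + y'); rewrite linearP yE y'E scalerDl scalerA.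
  have [h [_ hS]] := kos_homotopy K xxs; exists (h n.+1 c).
  by rewrite -hS c0 linear0 addr0.
have /choice [H HE] := fun j => ext_torsion_cycle_step (kos_finite K j.+1)
  (@kos_projective _ _ K j.+1) (@kos_dd _ _ K j) (@JK j).
exists H; split=> [j|N I T E m mT cE tH]; first by case: (HE j).
set r := size xs in tH *.
(* Descending induction on the degree [r - l] of the boundaries, which vanish for [l = 0] because
   the complex is zero above [r]. *)
have key l : (l <= r)%N -> forall B (b : {linear B -> K (r - l)%N}), injective b ->
    (forall x, (exists y, kos_d K (r - l) y = x) <-> exists y, b y = x) ->
    ext_torsion I T (m + l) B.
  elim: l => [_|l IHl lr] B b bi bE.
    apply: ext_torsion_zero => // x; apply: bi.
    have [y <-] := (bE (b x)).2 (ex_intro _ x erefl).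
    by rewrite (@kos_bounded _ _ K (r - 0).+1 _ y) ?linear0 // subn0.
  have [B1 [b1 [b1i b1E]]] :=
    submodule_embedding (range_submodule (kos_d K (r - l.+1).+1)).
  rewrite addnS; have [_ _ step] := HE (r - l.+1)%N.
  apply: (step _ _ _ _ _ _ b1 b) => //.
    have := tH (r - l.+1)%N; rewrite -subSn // subSS subKn; last exact: ltnW.
    by apply; rewrite leq_subr.
  (* The type of [b1] depends on the index, so the data are generalized before it is rewritten. *)
  move: (IHl (ltnW lr)) b1 b1i b1E; rewrite -{1 2}[(r - l)%N]/((r - l)%N).
  have -> : (r - l)%N = (r - l.+1).+1 by rewrite -subSn // subSS.
  by move=> IH b1 b1i b1E; exact: (IH B1 b1).
have [B [b [bi bE]]] := submodule_embedding (range_submodule (kos_d K 0)).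
have tB : ext_torsion I T (m + r) B.
  by have := key r (leqnn r); rewrite subnn; apply; [exact: bi|].
have [q [qs qJ]] := cE.
have [q0 q0E] : exists q0 : {linear K 0 -> E}, forall a, q0 (kos_phi K a) = q a.
  apply: linear_descend => [|a]; first exact: kos_phi_surj.
  by rewrite -[X in _ = X -> _](linear0 (kos_phi K)) => /kos_phi_inj ->; rewrite linear0.
have bq : short_exact b q0.
  split=> // [z|c].
    by have [a <-] := qs z; exists (kos_phi K a).
  rewrite -bE /=; split=> [|[y <-]]; last first.
    by have [a [Ja ->]] := kos_im mJ Jxs y; rewrite q0E; apply/qJ.
  have [a <-] := kos_phi_surj c; rewrite q0E => /qJ.
  pose P : set R^o := [set a | exists y, kos_d K 0 y = kos_phi K a].
  apply: (xsJ P) => [|x xxs].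
    split=> [|u v w [y yE] [y' y'E]]; first by exists 0; rewrite !linear0.
    by exists (u *: y + y'); rewrite !linearP yE y'E.
  have [h [h0 _]] := kos_homotopy K xxs; exists (h 0 (kos_phi K 1)).
  by rewrite h0 -linearZ; congr (kos_phi K _); exact: mulr1.
apply: (ext_torsion_quot bq mT tB); apply: ext_torsion_projective => //.
exact: kos_projective.
Qed.

Lemma cyclic_ext_torsion N (I : injective_resolution N) T i E M J :
  cyclic E J -> cyclic M J -> ext_torsion I T i E -> ext_torsion I T i M.
Proof.
move=> [q [qs qJ]] [q' [q's q'J]] tE f f0.
have [|u uE] := linear_descend (q := q) (f := q') qs; first by move=> a /qJ/q'J.
have [|v vE] := linear_descend (q := q') (f := q) q's; first by move=> a /q'J/qJ.
have [t [Tt [g gE]]] := tE (f \o u) (fun x => f0 _).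
exists t; split=> //; exists (g \o v) => x; have [a <-] := q's x.
by rewrite /= vE -gE /= uE.
Qed.

(* After inverting a suitable [s], [M] is an iterated extension of copies of [R/J]. *)
Lemma ext_torsion_generic N (I : injective_resolution N) J M :
  submodule J -> prime_ideal J -> finite_module M -> killed_by J M ->
  exists s : R, ~ J s /\ forall T i a, multiplicative T -> T (a * s) ->
    (forall E, cyclic E J -> ext_torsion I T i E) -> ext_torsion I T i M.
Proof.
move=> mJ [nJ1 Jp] Mf kM.
pose Psi M := exists s : R, ~ J s /\ forall T i a, multiplicative T -> T (a * s) ->
  (forall E, cyclic E J -> ext_torsion I T i E) -> ext_torsion I T i M.
apply: (@finite_devissage R Psi (killed_by J) _ _ _ _ M Mf kM) => {M Mf kM}.
- move=> A B C i q [ii qs _] kB; split=> [a m Ja|a m Ja].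
    by apply: ii; rewrite linearZ /= linear0; exact: kB.
  by have [y <-] := qs m; rewrite -linearZ kB // linear0.
- by move=> M _ M0; exists 1; split=> // T i a mT _ _; exact: ext_torsion_zero.
- move=> A B C i q iq [s [nJs tA]] [t [nJt tC]]; exists (s * t).
  split=> [/Jp []//|T k a mT Tast tE].
  apply: (ext_torsion_mid iq mT).
    by apply: (tA T k (a * t)) => //; rewrite -mulrA [t * s]mulrC.
  by apply: (tC T k (a * s)) => //; rewrite -mulrA.
move=> M J' kM cM; have [q [qs qJ']] := cM.
have JJ' : J `<=` J'.
  move=> a Ja; apply/qJ'; have -> : q a = (a : R) *: q 1.
    by rewrite -linearZ; congr (q _); exact: (esym (mulr1 _)).
  exact: kM.
have [J'J|] := pselect (J' `<=` J).
  exists 1; split=> // T i a mT _; apply.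
  by have -> : J = J' by apply/seteqP.
(* A cyclic piece with larger annihilator is killed by some [s] outside [J]. *)
move=> /existsNP [s /not_implyP [J's nJs]]; exists s; split=> // T i a mT Tas _.
apply: (ext_torsion_kill Tas) => m.
by rewrite -scalerA (cyclic_ann m cM J's) scaler0.
Qed.

End KoszulWindow.

(** * The two implications *)

Section Main.
Variables (R : comPzRingType) (Rn : noetherian R).
Variables (N : lmodType R) (Nf : finite_module N) (I : injective_resolution N).
Implicit Types (A B C M : lmodType R) (J : set R^o).

Lemma spec_submodule (p : spec R) : submodule ([set x | x \in p] : set R^o).
Proof. exact: (spec_submod p). Qed.

Lemma prime_ideal_spec J : submodule J -> prime_ideal J ->
  exists p : spec R, J = [set x | x \in p].
Proof.
move=> mJ [J1 Jp].
have p1 : (1 : R) \notin (fun x => `[< J x >] : bool).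
  by apply/negP => /asboolP.
have pM (a b : R) : a * b \in (fun x => `[< J x >] : bool) ->
    (a \in (fun x => `[< J x >] : bool)) || (b \in (fun x => `[< J x >] : bool)).
  by move=> /asboolP /Jp [] ?; apply/orP; [left|right]; apply/asboolP.
exists (Spec (submodule_mod_closed mJ) p1 pM).
by apply/seteqP; split=> x /= /asboolP.
Qed.

Lemma cyclic_finite M J : cyclic M J -> finite_module M.
Proof.
move=> [q [qs _]]; exists 1%N, (fun=> q 1) => m; have [a <-] := qs m.
exists (fun=> a); rewrite big_ord1 -linearZ; congr (q _).
exact: (esym (mulr1 _)).
Qed.

(* For a prime [J] not containing [x]: [0 -> R/J -x-> R/J -> R/(J + x) -> 0]. *)
Lemma cyclic_prime_mul M J (x : R) : cyclic M J -> prime_ideal J -> ~ J x ->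
  exists (C : lmodType R) (i : {linear M -> M}) (q : {linear M -> C}) J',
  [/\ short_exact i q, forall m, i m = x *: m, cyclic C J' & J `<` J'].
Proof.
move=> cM [_ Jp] nJx; have [q [qs qJ]] := cM.
have [i iE] : exists i : {linear M -> M}, forall m, i m = x *: m.
  by apply: linear_of => a u v; rewrite scalerDr !scalerA mulrC.
have qZ (a b : R) : q (a * b) = a *: q b by rewrite -linearZ.
have ii : injective i.
  apply: linear_inj => m; have [a <-] := qs m.
  by rewrite iE -qZ => /qJ /Jp [//|/qJ].
have [C [p ip]] := cokernel_short_exact ii.
exists C, i, p, [set a | exists y, i y = q a]; split=> //.
  exact: cyclic_quotient ip qs.
split=> [a Ja|/(_ x) h]; first by exists 0; rewrite linear0; apply/esym/qJ.
apply/nJx/h; exists (q 1); rewrite iE -linearZ; congr (q _).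
exact: mulr1.
Qed.

Section Localize.
Variable p : spec R.

Let mT := prime_compl_multiplicative p.

(** If [J] is not inside [p], an element of [J] outside [p] kills R/J; if it is properly inside,
    Nakayama's lemma applies with [x] in [p] outside [J]. Degree [k] of [A] needs degree [k.+1] of
    [C], so all degrees from [n] on are treated together. *)
Lemma ext_torsion_descend M n : cyclic M [set x | x \in p] ->
  (forall i, (n <= i)%N -> ext_torsion I [set 1] i M) ->
  forall M' J, cyclic M' J -> forall i, (n <= i)%N ->
  ext_torsion I (prime_compl p) i M'.
Proof.
move=> cM tM M' J cM'.
pose Psi A := forall i, (n <= i)%N -> ext_torsion I (prime_compl p) i A.
apply: (@cyclic_devissage R Rn Psi _ _ _ M' J cM') => {M' J cM'}.
- by move=> A A0 i _; exact: ext_torsion_zero.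
- by move=> A B C a q aq tA tC i ni; apply: (ext_torsion_mid aq mT); [exact: tA|exact: tC].
move=> A J cA pJ IH.
have [Jp|] := pselect (J `<=` [set x | x \in p]); last first.
  move=> /existsNP [t /not_implyP [Jt /negP tp]] i _.
  by apply: (@ext_torsion_kill _ _ _ (prime_compl p) _ _ t tp) => m; exact: cyclic_ann cA Jt.
have [pJ'|] := pselect ([set x | x \in p] `<=` J).
  move=> i ni; have JE : [set x | x \in p] = J by apply/seteqP.
  rewrite JE in cM; apply: (cyclic_ext_torsion cM cA).
  apply: ext_torsion_sub (tM i ni) => _ ->; exact: spec_compl1.
move=> /existsNP [x /not_implyP [xp nJx]].
have [C [i [q [J' [iq iE cC JJ']]]]] := cyclic_prime_mul cA pJ nJx.
move=> k nk; apply: (@ext_torsion_nakayama R N I (prime_compl p) k A x mT).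
- by apply: finite_ext_finite => //; exact: cyclic_finite cA.
- by move=> t r Tt; exact: prime_complD.
apply: (ext_torsion_mul_surj iq iE).
by apply: (IH _ _ cC JJ'); exact: leqW.
Qed.

(** Index [n] of [ext_torsion] is Ext^(n+1)(R/J, -), which is Ext^1 into the cosyzygy of index [n].
    Baer's criterion is applied over [R], and injectivity then descends to the local ring. *)
Lemma ext_vanishing_injdim M n : cyclic M [set x | x \in p] ->
  (forall i, (n <= i)%N -> ext_torsion I [set 1] i M) ->
  injdim_le (locmod p N : lmodType (locring p)) n.
Proof.
move=> cM tM; pose K := tight_resolution (locmod p N : lmodType (locring p)).
exists K; apply: tight_resolution_stop.
have [c [ci cE]] := tight_resolution_kernel (locmod p N : lmodType (locring p)) n.
apply/restr_injective_descend/baer_injective.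
apply: (@cosyzygy_baer R _ (restr_resolution K) n _ (restr_map c) ci cE).
move=> M' J cM'; apply/(ext_torsion_localization Rn I _ _ (cyclic_finite cM')).
exact: (ext_torsion_descend cM tM cM' (leqnn n)).
Qed.

(** A resolution over the local ring restricts to one over [R], whose terms beyond [n] are zero. *)
Lemma injdim_ext_torsion n : injdim_le (locmod p N : lmodType (locring p)) n ->
  forall M i, finite_module M -> (n <= i)%N -> ext_torsion I (prime_compl p) i M.
Proof.
move=> [K K0] M i Mf ni.
apply/(ext_torsion_localization Rn I (restr_resolution K) _ Mf) => f f0.
exists 1; split=> //; exists \0 => x; rewrite [ires_d _ _ _]linear0.
exact: (K0 i.+1 _ (1 *: f x)).
Qed.

End Localize.

(* A single [s] for all degrees: [s] is chosen to kill the [Ext] groups in [r + 1]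
   consecutive degrees, and [ext_torsion_window] propagates this upwards. *)
Lemma ext_finite_torsion_prime (p : spec R) n M : cyclic M [set x | x \in p] ->
  injdim_le (locmod p N : lmodType (locring p)) n ->
  exists s : R, s \notin p /\
    forall i, (n <= i)%N -> ext_torsion I [set t | exists k, t = s ^+ k] i M.
Proof.
set J := [set x | x \in p] => cM pn.
have mT := prime_compl_multiplicative p; have [_ TM] := mT.
have mJ := cyclic_submodule cM.
have pJ : prime_ideal J.
  split; first by apply/negP; exact: spec_proper.
  by move=> a b /(spec_prime p) /orP.
have [r [g [gJ Jg]]] := noetherian_ideal Rn mJ.
have [||H [Hf window]] := @ext_torsion_window R Rn [seq g i | i <- enum 'I_r] J mJ.
- by move=> x /mapP [i _ ->]; exact: gJ.
- move=> P mP Pg x /Jg [c ->]; apply: submodule_sum => // i.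
  by apply: Pg; apply/map_f; rewrite mem_enum.
rewrite size_map size_enum_ord in window.
(* [u j] handles index [n + j] of the initial window, where torsion comes from finite injective
   dimension. *)
have /choice [u uE] : forall j : 'I_r.+1, exists u, prime_compl p u /\
    forall T a, T (a * u) -> ext_torsion I T (n + j) M.
  move=> j; apply: ext_torsion_bounded mT _ _.
    by apply: finite_ext_finite => //; exact: cyclic_finite cM.
  apply: (injdim_ext_torsion pn) (cyclic_finite cM) _; exact: leq_addr.
(* [v j] reduces torsion for the homology [H j] to torsion for R/J. *)
have /choice [v vE] : forall j : 'I_r, exists s, prime_compl p s /\
    forall T i a, multiplicative T -> T (a * s) ->
    (forall E, cyclic E J -> ext_torsion I T i E) -> ext_torsion I T i (H j).
  move=> j; have [Hjf Hjk] := Hf j.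
  have [s [Js sE]] := ext_torsion_generic I mJ pJ Hjf Hjk.
  by exists s; split=> //; apply/negP.
have [u0 [Tu u0E]] := common_multiple mT (fun j => (uE j).1).
have [v0 [Tv v0E]] := common_multiple mT (fun j => (vE j).1).
exists (u0 * v0); split; first exact: TM.
set T := [set t | _].
have mS : multiplicative T.
  split; first by exists 0%N.
  by move=> _ _ [k ->] [l ->]; exists (k + l)%N; rewrite exprD.
have Ts : T (u0 * v0) by exists 1%N.
suff main k i : (i < k)%N -> ext_torsion I T (n + i) M.
  by move=> i ni; rewrite -(subnKC ni); exact: (main (i - n).+1).
elim: k i => // k IHk i; rewrite ltnS leq_eqVlt => /orP[/eqP ->|]; last exact: IHk.
have [kr|rk] := ltnP k r.+1.
  have [c u0c] := u0E (Ordinal kr).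
  by apply: ((uE (Ordinal kr)).2 T (v0 * c)); rewrite -mulrA -u0c mulrC.
(* Beyond the initial window: the propagation is applied with [m = n + (k - r.+1)] and uses only
   indices below [n + k]. *)
rewrite -[X in (n + X)%N](subnK rk) !addnS addnA; apply: window => // j jr.
have [c v0c] := v0E (Ordinal jr).
apply: ((vE (Ordinal jr)).2 T _ (u0 * c)) => // [|E cE].
  by rewrite -mulrA -v0c.
rewrite -addnA; apply: (cyclic_ext_torsion cM cE); apply: IHk.
rewrite -[X in (_ < X)%N](subnK rk) ltn_add2l.
exact: leq_ltn_trans (leq_subr _ _) (ltnSn r).
Qed.

Lemma injdim_ext_vanishing :
  (forall p : spec R, finite_injdim (locmod p N : lmodType (locring p))) ->
  forall M, finite_module M ->
  exists n, forall i, (n <= i)%N -> ext_torsion I [set 1] i M.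
Proof.
move=> fid M Mf; have m1 := multiplicative1 R.
pose Psi A := exists n, forall i, (n <= i)%N -> ext_torsion I [set 1] i A.
have Psi0 A : zero_module A -> Psi A.
  by move=> A0; exists 0%N => i _; exact: ext_torsion_zero.
have PsiD A B C (i : {linear A -> B}) (q : {linear B -> C}) :
    short_exact i q -> Psi A -> Psi C -> Psi B.
  move=> iq [a tA] [c tC]; exists (maxn a c) => k; rewrite geq_max => /andP[ak ck].
  by apply: (ext_torsion_mid iq m1); [exact: tA|exact: tC].
suff cyc A J : cyclic A J -> Psi A.
  apply: (@finite_devissage R Psi (fun=> True) _ _ PsiD _ M Mf) => // A.
    by move=> _; exact: Psi0.
  by move=> J _; exact: cyc.
move: A J; apply: (cyclic_devissage Rn Psi0 PsiD) => {Mf}M J cM pJ IH.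
have [p pE] := prime_ideal_spec (cyclic_submodule cM) pJ.
have [n pn] := fid p; rewrite pE in cM.
have [s [sp tM]] := ext_finite_torsion_prime cM pn.
have [|||C [i [q [J' [iq iE cC JJ']]]]] := @cyclic_prime_mul M J s.
- by rewrite pE.
- by [].
- by rewrite pE; apply/negP.
(* From index [c] on, Ext of the quotient by [s] vanishes, so [s] acts injectively and [s]-power
   torsion is zero. *)
have [c tC] := IH _ _ cC JJ'.
exists (maxn n c) => k; rewrite geq_max => /andP[nk ck].
exact: (ext_torsion_mul_powers iq iE (fun t Tt => Tt) (tM k nk) (tC k ck)).
Qed.

End Main.

Theorem theorem1p2 (R : comPzRingType) (R_noetherian : noetherian R)
    (N : lmodType R) (N_finite : finite_module N) :
  (forall p : spec R, finite_injdim (locmod p N : lmodType (locring p))) <->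
  (forall M : lmodType R, finite_module M ->
     exists n : int, forall i : nat, n < i%:Z -> zero_module (Ext i M N)).
Proof.
pose I := tight_resolution N.
split=> [fid M Mf|vanish p].
  have [n tM] := injdim_ext_vanishing R_noetherian N_finite I fid Mf.
  (* The nonnegative bound excludes degree 0; degree [i.+1] of Ext is index [i] of [ext_torsion]. *)
  exists n%:Z => -[//|i]; rewrite ltz_nat => ni.
  by apply/(Ext_zeroP _ I); exact: tM.
(* The single test module R/p suffices for the prime [p]. *)
have [M [q [qs qp]]] := submodule_quotient (spec_submodule p).
have cM : cyclic M [set x | x \in p] by exists q.
have [n nM] := vanish M (cyclic_finite cM).
(* The bound [n] may be negative, whereas an injective dimension bound is a natural number. *)
exists `|n|%N; apply: (ext_vanishing_injdim R_noetherian N_finite (I := I) cM).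
move=> i ni; apply/Ext_zeroP; apply: nM.
by apply: Order.POrderTheory.le_lt_trans (Num.Theory.ler_norm n) _; rewrite -abszE ltz_nat.
Qed.
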